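(* Let $\mathbf F$ be a portrait of degree $d\ge2$ with underlying map $F:Y\to Z$, let $(\mathcal F_n)_n$ be a sequence in $\mathbf{Rat}_{\mathbf F}$ and let $\mathcal F\in\widehat{\mathbf{Rat}}_{\mathbf F}$. Then $$\mathcal F_n\to\mathcal F\quad\text{if and only if}\quad \mathbf I([\mathcal F_n])\to\mathbf I([\mathcal F])\ \text{ in }\ \widehat{\mathbf{Mod}}_Y.$$
   Context: $\mathbb S=\mathbb P^1(\mathbb C)$. A portrait $\mathbf F$ of degree $d\ge2$ is a pair $(F,\deg)$ with $F:Y\to Z$ a map between finite sets and $\deg:Y\to\{1,\dots,d\}$ such that $\sum_{a\in Y}(\deg(a)-1)=2d-2$ and $\sum_{a\in F^{-1}(b)}\deg(a)=d$ for all $b\in Z$. Sets used as markings have at least three elements. Trees of spheres. A combinatorial tree marked by $X$ is a finite tree $T$ whose set of leaves is $X$ and all of whose internal vertices have valence $\ge3$. A tree of spheres $\mathcal T$ marked by $X$ is a combinatorial tree $T$ marked by $X$ with, for each internal vertex $v$, a Riemann sphere $\mathbb S_v$ and an injection $i_v:E_v\to\mathbb S_v$ of the set $E_v$ of edges adjacent to $v$; $X_v:=i_v(E_v)$, and $a_v:X\to\mathbb S_v$ is $a_v(x)=i_v(e)$ with $e\in E_v$ in the component of $T\setminus\{v\}$ containing $x$. A tree map sends internal vertices to internal vertices, leaves to leaves, edges to edges, adjacent vertices to adjacent vertices. An isomorphism $\mathcal M:\mathcal T_1\to\mathcal T_2$ is a bijective tree map $M$ that is the identity on $X$, with projective isomorphisms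 $m_v:\mathbb S_v\to\mathbb S_{M(v)}$ such that $m_v(i_v(e))=i_{M(v)}(M(e))$. $\widehat{\mathbf{Mod}}_X$ is the set of isomorphism classes, with the topology induced by the injective map $\mathfrak B_X:\widehat{\mathbf{Mod}}_X\to\mathbb S^{\mathrm{Quad}_X}$, $[\mathcal T]\mapsto(\alpha_t(x))_{(t,x)}$, where $\mathrm{Quad}_X$ is the set of quadruples of distinct elements of $X$ and, for $t=(x_0,x_1,x_\infty)$, $\alpha_t=\sigma_t\circ a_{v_t}$ with $v_t$ the unique vertex having $x_0,x_1,x_\infty$ in different components of $T\setminus\{v_t\}$ and $\sigma_t:\mathbb S_{v_t}\to\mathbb S$ the projective isomorphism sending $a_{v_t}(x_0),a_{v_t}(x_1),a_{v_t}(x_\infty)$ to $0,1,\infty$. Covers. A cover $\mathcal F:\mathcal T^Y\to\mathcal T^Z$ between trees of spheres is a tree map $F:T^Y\to T^Z$ and, for each internal vertex $v$ of $T^Y$ with $w=F(v)$, a holomorphic ramified cover $f_v:\mathbb S_v\to\mathbb S_w$ such that $f_v:\mathbb S_v-Y_v\to\mathbb S_w-Z_w$ is a cover, $f_v\circ i_v=i_w\circ F$, and for each edge $e$ between internal vertices $v,v'$ the local degree of $f_v$ at $i_v(e)$ equals that of $f_{v'}$ at $i_{v'}(e)$. Its portrait is $(F|_Y,\deg|_Y)$, where $\deg(y)$ is the local degree of $f_v$ at $i_v(\{v,y\})$, $v$ being the internal vertex adjacent to $y\in Y$. $\widehat{\mathbf{Rat}}_{\mathbf F}$ is the set of covers with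 portrait $\mathbf F$; $\mathbf{Rat}_{\mathbf F}$ is the subset of covers between trees with a unique internal vertex, written as triples $(f_n,a_n^Y,a_n^Z)$ with $f_n:\mathbb S_n^Y\to\mathbb S_n^Z$ a rational map between Riemann spheres and $a_n^Y:Y\to\mathbb S_n^Y$, $a_n^Z:Z\to\mathbb S_n^Z$ the marking injections. Covers $\mathcal F_1,\mathcal F_2$ are isomorphic if there are isomorphisms $\mathcal M^Y:\mathcal T_1^Y\to\mathcal T_2^Y$, $\mathcal M^Z:\mathcal T_1^Z\to\mathcal T_2^Z$ with $M^Z\circ F_1=F_2\circ M^Y$ and $f_{2,M^Y(v)}\circ m^Y_v=m^Z_{F_1(v)}\circ f_{1,v}$ for all internal $v$. $[\mathcal F]$ denotes the isomorphism class and $\mathbf I([\mathcal F:\mathcal T^Y\to\mathcal T^Z])=[\mathcal T^Y]$. Convergence. $\mathcal F_n=(f_n,a_n^Y,a_n^Z)\in\mathbf{Rat}_{\mathbf F}$ converges to $\mathcal F:\mathcal T^Y\to\mathcal T^Z$ in $\widehat{\mathbf{Rat}}_{\mathbf F}$, written $\mathcal F_n\to\mathcal F$, if for all pairs of internal vertices $v$ of $T^Y$ and $w=F(v)$ there are sequences of isomorphisms $\phi^Y_{n,v}:\mathbb S_n^Y\to\mathbb S_v$ and $\phi^Z_{n,w}:\mathbb S_n^Z\to\mathbb S_w$ such that $\phi^Y_{n,v}\circ a_n^Y\to a_v^Y$, $\phi^Z_{n,w}\circ a_n^Z\to a_w^Z$, and $\phi^Z_{n,w}\circ f_n\circ(\phi^Y_{n,v})^{-1}$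 converges to $f_v$ locally uniformly outside $Y_v$. *)

(* Defs.v *)
From HB Require Import structures.
From mathcomp Require Import all_boot all_order all_algebra.
From mathcomp Require Import generic_quotient.
From mathcomp Require Import complex ring.
From mathcomp Require Import all_classical all_reals all_analysis.
Set Implicit Arguments.
Unset Strict Implicit.
Unset Printing Implicit Defensive.
Import Order.TTheory GRing.Theory Num.Theory numFieldNormedType.Exports.
Local Open Scope classical_set_scope.
Local Open Scope ring_scope.

(* P^1(C) as C together with the point at infinity [None]. *)
Definition P1 (R : realType) := option R[i].

(* Stereographic projection onto the unit sphere of R^3, from which P^1(C) takes
   its topology and its uniform structure (that of the chordal distance). *)
Definition stereo (R : realType) (z : option R[i]) : R * R * R :=
  if z is Some w then
    let x := complex.Re w in let y := complex.Im w in
    let s := 1 + x ^+ 2 + y ^+ 2 in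
    (2 * x / s, 2 * y / s, (x ^+ 2 + y ^+ 2 - 1) / s)
  else (0, 0, 1).

HB.instance Definition _ (R : realType) := Choice.on (P1 R).
HB.instance Definition _ (R : realType) :=
  PseudoMetric.copy (P1 R) (initial_topology (@stereo R)).

(* The projective isomorphism z |-> (a z + b) / (c z + d). *)
Record mobius (R : realType) := Mobius {
  mob_a : R[i]; mob_b : R[i]; mob_c : R[i]; mob_d : R[i];
  mob_det : mob_a * mob_d - mob_b * mob_c != 0 }.

Definition mob_fun (R : realType) (m : mobius R) (z : P1 R) : P1 R :=
  match z with
  | Some w => if mob_c m * w + mob_d m == 0 then None
              else Some ((mob_a m * w + mob_b m) / (mob_c m * w + mob_d m))
  | None => if mob_c m == 0 then None else Some (mob_a m / mob_c m)
  end.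
Coercion mob_fun : mobius >-> Funclass.

HB.instance Definition _ (R : realType) := gen_eqMixin (mobius R).
HB.instance Definition _ (R : realType) := gen_choiceMixin (mobius R).

Lemma mob_id_subproof (R : realType) : 1 * 1 - 0 * 0 != 0 :> R[i].
Proof. by rewrite mulr0 subr0 mulr1 oner_neq0. Qed.
Definition mob_id (R : realType) : mobius R := Mobius (mob_id_subproof R).

Lemma mob_inv_subproof (R : realType) (m : mobius R) :
  mob_d m * mob_a m - (- mob_b m) * (- mob_c m) != 0.
Proof. by rewrite mulrNN mulrC mob_det. Qed.
Definition mob_inv (R : realType) (m : mobius R) : mobius R :=
  Mobius (mob_inv_subproof m).

(* A nonconstant rational map num / den in lowest terms: these are the
   holomorphic ramified covers from P^1(C) to itself. *)
Record ratmap (R : realType) := RatMap {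
  rm_num : {poly R[i]};
  rm_den : {poly R[i]};
  rm_coprime : coprimep rm_num rm_den;
  rm_nonconst : (1 < maxn (size rm_num) (size rm_den))%N }.

Definition rm_degree (R : realType) (f : ratmap R) : nat :=
  (maxn (size (rm_num f)) (size (rm_den f))).-1.

Definition rm_fun (R : realType) (f : ratmap R) (z : P1 R) : P1 R :=
  match z with
  | Some w => if (rm_den f).[w] == 0 then None
              else Some ((rm_num f).[w] / (rm_den f).[w])
  | None => let n := rm_degree f in
            if (rm_den f)`_n == 0 then None
            else Some ((rm_num f)`_n / (rm_den f)`_n)
  end.
Coercion rm_fun : ratmap >-> Funclass.

(* The finite part of the fibre of f over w is the set of zeros, counted with
   multiplicity, of this polynomial. *)
Definition rm_fiber (R : realType) (f : ratmap R) (w : P1 R) : {poly R[i]} :=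
  if w is Some c then rm_num f - c *: rm_den f else rm_den f.

(* The local degree of f at z. At infinity it is the order of vanishing of the
   form of degree [rm_degree f] whose dehomogenization is [rm_fiber f (f z)]. *)
Definition local_degree (R : realType) (f : ratmap R) (z : P1 R) : nat :=
  let h := rm_fiber f (f z) in
  if z is Some w then mup w h else (rm_degree f - (size h).-1)%N.

(* f restricts to a topological covering map from A to B, where A and B are open
   subsets: B is covered by evenly covered open sets U, and VV is the family of
   sheets over U. *)
Definition covering_map (S T : topologicalType) (f : S -> T)
    (A : set S) (B : set T) : Prop :=
  f @` A `<=` B /\
  forall b, B b -> exists U : set T, [/\ open U, U b, U `<=` B &
    exists VV : set (set S), [/\ trivIset VV id,
      \bigcup_(V in VV) V = A `&` f @^-1` U &
      forall V, VV V ->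
        [/\ open V, {in V &, injective f}, f @` V = U,
            (forall x, V x -> {for x, continuous f}) &
            forall W : set S, open W -> W `<=` V -> open (f @` W)]]].

(* Trees marked by X: the internal vertices are labelled by 'I_n, the leaves are
   the elements of X. *)
Record ctree (X : finType) := CTree {
  nint : nat;
  adj : 'I_nint + X -> 'I_nint + X -> bool;
  adj_sym : symmetric adj;
  adj_irr : irreflexive adj;
  adj_connected : forall u v, connect adj u v;
  adj_acyclic : forall c, ucycle adj c -> (size c <= 2)%N;
  adj_leaf : forall x : X, #|adj (inr x)| = 1%N;
  adj_internal : forall v : 'I_nint, (3 <= #|adj (inl v)|)%N }.

Definition vertex (X : finType) (T : ctree X) : finType := ('I_(nint T) + X)%type.

(* u is joined to w by a path in the complement of the internal vertex v. *)
Definition connect_off (X : finType) (T : ctree X) (v : 'I_(nint T)) :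
    rel (vertex T) :=
  connect [rel a b : vertex T | [&& adj a b, a != inl v & b != inl v]].

(* The neighbour u of v such that the edge {v, u} leads to the component of
   T - {v} containing the leaf x; the value [inl v] is never attained. *)
Definition toward (X : finType) (T : ctree X) (v : 'I_(nint T)) (x : X) :
    vertex T :=
  odflt (inl v) [pick u : vertex T | adj (inl v) u && connect_off v u (inr x)].

(* Every sphere S_v is a copy of P^1(C). The edge {v, u} is represented by the
   neighbour u of v, so [pt v u] stands for i_v({v, u}) and is meaningful only
   when u is adjacent to v. *)
Record stree (R : realType) (X : finType) := STree {
  st_tree :> ctree X;
  pt : 'I_(nint st_tree) -> vertex st_tree -> P1 R;
  pt_inj : forall v, {in adj (inl v) &, injective (pt v)} }.

Definition marked_points (R : realType) (X : finType) (T : stree R X)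
    (v : 'I_(nint T)) : set (P1 R) :=
  [set z | exists2 u : vertex T, adj (inl v) u & z = pt v u].

Definition marking (R : realType) (X : finType) (T : stree R X)
    (v : 'I_(nint T)) (x : X) : P1 R := pt v (toward v x).

Record tree_map (X1 X2 : finType) (T1 : ctree X1) (T2 : ctree X2) := TreeMap {
  tm_int : 'I_(nint T1) -> 'I_(nint T2);
  tm_leaf : X1 -> X2;
  tm_vert := (fun u : vertex T1 => match u with
    | inl v => inl (tm_int v) | inr x => inr (tm_leaf x) end : vertex T2);
  tm_adj : forall u v : vertex T1, adj u v -> adj (tm_vert u) (tm_vert v) }.

Record stree_iso (R : realType) (X : finType) (T1 T2 : stree R X) := STreeIso {
  si_map : tree_map T1 T2;
  si_bij : bijective (tm_vert si_map);
  si_leaf : forall x, tm_leaf si_map x = x;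
  si_mob : 'I_(nint T1) -> mobius R;
  si_pt : forall (v : 'I_(nint T1)) (u : vertex T1), adj (inl v) u ->
    si_mob v (pt v u) = pt (tm_int si_map v) (tm_vert si_map u) }.

(* The point of P^1(C) with homogeneous coordinates [x : y]. *)
Definition hproj (R : realType) (x y : R[i]) : P1 R :=
  if y == 0 then None else Some (x / y).

Lemma hprojP (R : realType) (z : P1 R) :
  exists x y, ((x != 0) || (y != 0)) /\ z = hproj x y.
Proof.
rewrite /hproj; case: z => [w|]; last by exists 1, 0; rewrite oner_neq0 !eqxx.
by exists w, 1; rewrite oner_eq0 orbT divr1.
Qed.

Lemma hproj_scale (R : realType) (k x y : R[i]) :
  k != 0 -> hproj (k * x) (k * y) = hproj x y.
Proof.
move=> k0; rewrite /hproj mulf_eq0 (negPf k0) /=; case: eqP => // /eqP y0.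
by congr Some; field; rewrite k0 y0.
Qed.

Lemma mob_hproj (R : realType) (m : mobius R) (x y : R[i]) :
  (x != 0) || (y != 0) ->
  m (hproj x y) = hproj (mob_a m * x + mob_b m * y) (mob_c m * x + mob_d m * y).
Proof.
rewrite /hproj; have [->|y0] := eqVneq y 0.
  rewrite !mulr0 !addr0 orbF => x0 /=; rewrite mulf_eq0 (negPf x0) orbF.
  by case: eqP => // /eqP c0; congr Some; field; rewrite c0 x0.
move=> _ /=.
have -> : mob_c m * (x / y) + mob_d m = (mob_c m * x + mob_d m * y) / y by field.
rewrite mulf_eq0 invr_eq0 (negPf y0) orbF; case: eqP => // /eqP e.
by congr Some; field; rewrite e y0.
Qed.

Lemma hproj_lin_neq0 (R : realType) (m : mobius R) (x y : R[i]) :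
  (x != 0) || (y != 0) ->
  (mob_a m * x + mob_b m * y != 0) || (mob_c m * x + mob_d m * y != 0).
Proof.
apply: contraLR; rewrite !negb_or !negbK => /andP[/eqP e1 /eqP e2].
apply/andP; split; apply/eqP; apply: (mulfI (mob_det m)).
- transitivity (mob_d m * (mob_a m * x + mob_b m * y)
                - mob_b m * (mob_c m * x + mob_d m * y)); first by ring.
  by rewrite e1 e2; ring.
- transitivity (mob_a m * (mob_c m * x + mob_d m * y)
                - mob_c m * (mob_a m * x + mob_b m * y)); first by ring.
  by rewrite e1 e2; ring.
Qed.

Lemma mob_idE (R : realType) (z : P1 R) : mob_id R z = z.
Proof.
have [x [y [xy ->]]] := hprojP z.
by rewrite mob_hproj //= !(mul1r, mul0r, addr0, add0r).
Qed.

Lemma mob_invK (R : realType) (m : mobius R) : cancel m (mob_inv m).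
Proof.
move=> z; have [x [y [xy ->]]] := hprojP z.
rewrite mob_hproj // mob_hproj ?hproj_lin_neq0 //=.
by rewrite -(hproj_scale x y (mob_det m)); congr hproj; ring.
Qed.

Lemma mob_comp_subproof (R : realType) (m2 m1 : mobius R) :
  (mob_a m2 * mob_a m1 + mob_b m2 * mob_c m1) *
  (mob_c m2 * mob_b m1 + mob_d m2 * mob_d m1) -
  (mob_a m2 * mob_b m1 + mob_b m2 * mob_d m1) *
  (mob_c m2 * mob_a m1 + mob_d m2 * mob_c m1) != 0.
Proof.
have := mulf_neq0 (mob_det m2) (mob_det m1).
by apply: contra => /eqP e; apply/eqP; rewrite -e; ring.
Qed.
Definition mob_comp (R : realType) (m2 m1 : mobius R) : mobius R :=
  Mobius (mob_comp_subproof m2 m1).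

Lemma mob_compE (R : realType) (m2 m1 : mobius R) (z : P1 R) :
  mob_comp m2 m1 z = m2 (m1 z).
Proof.
have [x [y [xy ->]]] := hprojP z.
by rewrite !mob_hproj ?hproj_lin_neq0 //=; congr hproj; ring.
Qed.

Lemma tm_vert_inj_adj (X1 X2 : finType) (T1 : ctree X1) (T2 : ctree X2)
    (M : tree_map T1 T2) : injective (tm_vert M) ->
  forall u v, adj (tm_vert M u) (tm_vert M v) -> adj u v.
Proof.
move=> Minj u v Muv.
have neq_uv : u != v by apply/eqP => e; rewrite e adj_irr in Muv.
have /connectP[p0 p0path vE] := adj_connected u v.
move: Muv neq_uv; rewrite {}vE; case/shortenP: p0path => p ppath puniq _ Muv neq_uv.
have Mp : path (@adj _ T2) (tm_vert M u) (map (tm_vert M) p).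
  rewrite path_map; apply: sub_path ppath => a b; exact: tm_adj.
have cyc : ucycle (@adj _ T2) (tm_vert M u :: map (tm_vert M) p).
  rewrite /ucycle /= rcons_path Mp last_map adj_sym Muv /=.
  by rewrite mem_map // map_inj_uniq.
have := adj_acyclic cyc; rewrite /= size_map ltnS.
case: p ppath Muv neq_uv {cyc puniq Mp} => [|w [|//]] /=; first by rewrite eqxx.
by rewrite andbT.
Qed.

Lemma stree_iso_refl (R : realType) (X : finType) (T : stree R X) :
  exists J : stree_iso T T, (forall u, tm_vert (si_map J) u = u) /\
    (forall v z, si_mob J v z = z).
Proof.
pose F := fun u : vertex T =>
  match u return vertex T with inl v => inl v | inr x => inr x end.
have FE u : F u = u by case: u.
have Fadj u v : adj u v -> adj (F u) (F v) by rewrite !FE.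
pose M := @TreeMap _ _ T T id id Fadj.
have Mbij : bijective (tm_vert M) by exists id => u; exact: FE.
have Mpt (v : 'I_(nint T)) (u : vertex T) : adj (inl v) u ->
  mob_id R (pt v u) = pt (tm_int M v) (tm_vert M u).
  by move=> _; rewrite mob_idE; congr pt; case: u.
exists (@STreeIso _ _ T T M Mbij (fun=> erefl) (fun=> mob_id R) Mpt).
by split=> [u|v z]; [exact: FE|exact: mob_idE].
Qed.

Lemma stree_iso_sym (R : realType) (X : finType) (T1 T2 : stree R X)
    (I : stree_iso T1 T2) :
  exists J : stree_iso T2 T1,
    [/\ cancel (tm_vert (si_map I)) (tm_vert (si_map J)),
        cancel (tm_vert (si_map J)) (tm_vert (si_map I)),
        cancel (tm_int (si_map I)) (tm_int (si_map J)) &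
        forall v z, si_mob J (tm_int (si_map I) v) (si_mob I v z) = z].
Proof.
case: I => M Mbij Ml m mpt /=; have Minj := bij_inj Mbij.
have int_inj : injective (tm_int M).
  move=> v w e; have /= := Minj (inl v) (inl w).
  by rewrite e => /(_ erefl) [].
have cardE : #|vertex T1| = #|vertex T2| by exact: bij_eq_card Mbij.
have [g gK Kg] : bijective (tm_int M).
  apply: inj_card_bij => //; rewrite !card_ord.
  by move: cardE; rewrite !card_sum !card_ord => /addIn ->.
pose F := fun u : vertex T2 =>
  match u return vertex T1 with inl v => inl (g v) | inr x => inr x end.
have FK : cancel F (tm_vert M) by case=> [v|x] /=; rewrite ?Kg ?Ml.
have KF : cancel (tm_vert M) F by case=> [v|x] /=; rewrite ?gK ?Ml.
have Fadj u v : adj u v -> adj (F u) (F v).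
  by move=> uv; apply: (tm_vert_inj_adj Minj); rewrite !FK.
pose N := @TreeMap _ _ T2 T1 g id Fadj.
have NE u : tm_vert N u = F u by [].
have Nbij : bijective (tm_vert N) by exists (tm_vert M) => u; rewrite NE.
have Npt (v : 'I_(nint T2)) (u : vertex T2) : adj (inl v) u ->
    mob_inv (m (g v)) (pt v u) = pt (tm_int N v) (tm_vert N u).
  move=> vu; have := mpt (g v) (F u) (Fadj _ _ vu).
  by rewrite FK Kg => <-; rewrite mob_invK.
exists (@STreeIso _ _ T2 T1 N Nbij (fun=> erefl) (fun v => mob_inv (m (g v))) Npt).
by split=> //= v z; rewrite gK mob_invK.
Qed.

Lemma stree_iso_trans (R : realType) (X : finType) (T1 T2 T3 : stree R X)
    (I : stree_iso T1 T2) (J : stree_iso T2 T3) :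
  exists K : stree_iso T1 T3,
    [/\ forall u, tm_vert (si_map K) u = tm_vert (si_map J) (tm_vert (si_map I) u),
        forall v, tm_int (si_map K) v = tm_int (si_map J) (tm_int (si_map I) v) &
        forall v z, si_mob K v z = si_mob J (tm_int (si_map I) v) (si_mob I v z)].
Proof.
case: I J => M Mbij Ml m mpt [N Nbij Nl n npt] /=.
pose F := fun u : vertex T1 => match u return vertex T3 with
  inl v => inl (tm_int N (tm_int M v)) | inr x => inr (tm_leaf N (tm_leaf M x)) end.
have FE u : F u = tm_vert N (tm_vert M u) by case: u.
have Fadj u v : adj u v -> adj (F u) (F v).
  by move=> uv; rewrite !FE; do 2 apply: tm_adj.
pose K := @TreeMap _ _ T1 T3 (tm_int N \o tm_int M) (tm_leaf N \o tm_leaf M) Fadj.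
have KE u : tm_vert K u = tm_vert N (tm_vert M u) by rewrite -FE.
have Kbij : bijective (tm_vert K).
  by apply: (eq_bij (bij_comp Nbij Mbij)) => u; rewrite KE.
have Kl x : tm_leaf K x = x by rewrite /= Ml Nl.
pose k v := mob_comp (n (tm_int M v)) (m v).
have Kpt (v : 'I_(nint T1)) (u : vertex T1) : adj (inl v) u ->
    k v (pt v u) = pt (tm_int K v) (tm_vert K u).
  move=> vu; rewrite /k mob_compE mpt // npt ?KE //.
  by have := tm_adj M vu.
exists (@STreeIso _ _ T1 T3 K Kbij Kl k Kpt).
by split=> //= v z; rewrite /k mob_compE.
Qed.

Definition stree_isob (R : realType) (X : finType) (T1 T2 : stree R X) : bool :=
  `[< inhabited (stree_iso T1 T2) >].

Lemma stree_isob_refl (R : realType) (X : finType) :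
  reflexive (@stree_isob R X).
Proof.
by move=> T; apply/asboolP; have [J _] := stree_iso_refl T; exists.
Qed.

Lemma stree_isob_sym (R : realType) (X : finType) :
  symmetric (@stree_isob R X).
Proof.
by move=> T1 T2; apply/asboolP/asboolP => -[I];
  have [J _] := stree_iso_sym I; exists.
Qed.

Lemma stree_isob_trans (R : realType) (X : finType) :
  transitive (@stree_isob R X).
Proof.
move=> T2 T1 T3 /asboolP[I] /asboolP[J]; apply/asboolP.
by have [K _] := stree_iso_trans I J; exists.
Qed.

HB.instance Definition _ (R : realType) (X : finType) := gen_eqMixin (stree R X).
HB.instance Definition _ (R : realType) (X : finType) :=
  gen_choiceMixin (stree R X).

Canonical stree_equiv (R : realType) (X : finType) :=
  EquivRel (@stree_isob R X) (@stree_isob_refl R X) (@stree_isob_sym R X)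
    (@stree_isob_trans R X).

Definition ModHat (R : realType) (X : finType) :=
  {eq_quot @stree_isob R X}%qT.
HB.instance Definition _ (R : realType) (X : finType) := Choice.on (ModHat R X).

Definition mod_class (R : realType) (X : finType) (T : stree R X) : ModHat R X :=
  (\pi_({eq_quot @stree_isob R X}) T)%qT.

(* The vertex v_t for t = (x0, x1, xoo). *)
Definition tripod (X : finType) (T : ctree X) (x0 x1 xoo : X) :
    option 'I_(nint T) :=
  [pick v : 'I_(nint T) | uniq [:: toward v x0; toward v x1; toward v xoo]].

Definition normalization (R : realType) (z0 z1 zoo : P1 R) : mobius R :=
  xget (mob_id R)
    [set m | [/\ m z0 = Some 0, m z1 = Some 1 & m zoo = None]].

(* The map alpha_t : X -> P^1(C) for t = (x0, x1, xoo). When these leaves are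
   distinct, [tripod] always returns a vertex. *)
Definition alpha (R : realType) (X : finType) (T : stree R X) (x0 x1 xoo x : X) :
    P1 R :=
  if tripod T x0 x1 xoo is Some v then
    normalization (marking v x0) (marking v x1) (marking v xoo) (marking v x)
  else None.

Definition Quad (X : finType) := {q : 4.-tuple X | uniq q}.

Definition stree_alpha (R : realType) (X : finType) (T : stree R X) :
    {ptws Quad X -> P1 R} :=
  fun q => alpha T (tnth (val q) 0) (tnth (val q) 1) (tnth (val q) 2%:R)
             (tnth (val q) 3%:R).

(* The map B_X. Isomorphic trees have the same image under [stree_alpha], so the
   choice of the representative is immaterial. *)
Definition mod_embed (R : realType) (X : finType) (c : ModHat R X) :
    {ptws Quad X -> P1 R} :=
  stree_alpha (repr (c : {eq_quot @stree_isob R X}%qT)).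

HB.instance Definition _ (R : realType) (X : finType) :=
  Topological.copy (ModHat R X) (initial_topology (@mod_embed R X)).

Record portrait (d : nat) (Y Z : finType) := Portrait {
  pmap : Y -> Z;
  pdeg : Y -> nat;
  pdeg_range : forall a, (0 < pdeg a <= d)%N;
  pdeg_critical : (\sum_(a : Y) (pdeg a - 1) = 2 * d - 2)%N;
  pdeg_fiber : forall b, (\sum_(a : Y | pmap a == b) pdeg a = d)%N }.

Record tree_cover (R : realType) (Y Z : finType) := TreeCover {
  tc_src : stree R Y;
  tc_tgt : stree R Z;
  tc_map : tree_map tc_src tc_tgt;
  tc_fun : 'I_(nint tc_src) -> ratmap R;
  tc_covering : forall v : 'I_(nint tc_src),
    covering_map (tc_fun v) (~` marked_points v)
      (~` marked_points (tm_int tc_map v));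
  tc_pt : forall (v : 'I_(nint tc_src)) (u : vertex tc_src), adj (inl v) u ->
    tc_fun v (pt v u) = pt (tm_int tc_map v) (tm_vert tc_map u);
  tc_degree : forall v v' : 'I_(nint tc_src), adj (inl v) (inl v' : vertex tc_src) ->
    local_degree (tc_fun v) (pt v (inl v')) =
    local_degree (tc_fun v') (pt v' (inl v)) }.

Arguments tc_fun {R Y Z} F v : rename.

Definition has_portrait (R : realType) (d : nat) (Y Z : finType)
    (F : tree_cover R Y Z) (P : portrait d Y Z) : Prop :=
  (forall y, tm_leaf (tc_map F) y = pmap P y) /\
  forall (v : 'I_(nint (tc_src F))) (y : Y),
    adj (inl v) (inr y : vertex (tc_src F)) ->
    local_degree (tc_fun F v) (pt v (inr y)) = pdeg P y.

(* The covers between trees of spheres with portrait P. *)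
Record RatHat (R : realType) (d : nat) (Y Z : finType) (P : portrait d Y Z) :=
  MkRatHat {
    rh_cover :> tree_cover R Y Z;
    rh_portrait : has_portrait rh_cover P }.

(* Those between trees with a unique internal vertex. *)
Record RatF (R : realType) (d : nat) (Y Z : finType) (P : portrait d Y Z) :=
  MkRatF {
    rf_cover :> RatHat R P;
    rf_src : nint (tc_src rf_cover) = 1%N;
    rf_tgt : nint (tc_tgt rf_cover) = 1%N }.

Definition the_vertex (X : finType) (T : ctree X) (h : nint T = 1%N) :
    'I_(nint T) := cast_ord (esym h) ord0.

(* The triple (f, a^Y, a^Z) of an element of RatF. *)
Definition rf_fun (R : realType) (d : nat) (Y Z : finType) (P : portrait d Y Z)
    (F : RatF R P) : ratmap R := tc_fun F (the_vertex (rf_src F)).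
Definition rf_aY (R : realType) (d : nat) (Y Z : finType) (P : portrait d Y Z)
    (F : RatF R P) : Y -> P1 R := marking (the_vertex (rf_src F)).
Definition rf_aZ (R : realType) (d : nat) (Y Z : finType) (P : portrait d Y Z)
    (F : RatF R P) : Z -> P1 R := marking (the_vertex (rf_tgt F)).

Definition tree_cover_iso (R : realType) (Y Z : finType)
    (F1 F2 : tree_cover R Y Z) : Prop :=
  exists (MY : stree_iso (tc_src F1) (tc_src F2))
         (MZ : stree_iso (tc_tgt F1) (tc_tgt F2)),
    (forall u, tm_vert (si_map MZ) (tm_vert (tc_map F1) u) =
               tm_vert (tc_map F2) (tm_vert (si_map MY) u)) /\
    forall v z, tc_fun F2 (tm_int (si_map MY) v) (si_mob MY v z) =
                si_mob MZ (tm_int (tc_map F1) v) (tc_fun F1 v z).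

Definition cover_isob (R : realType) (d : nat) (Y Z : finType)
    (P : portrait d Y Z) (F1 F2 : RatHat R P) : bool :=
  `[< tree_cover_iso F1 F2 >].

Lemma cover_isob_refl (R : realType) (d : nat) (Y Z : finType)
  (P : portrait d Y Z) : reflexive (@cover_isob R d Y Z P).
Proof.
move=> F; apply/asboolP.
have [I [I1 I2]] := stree_iso_refl (tc_src F).
have [J [J1 J2]] := stree_iso_refl (tc_tgt F).
exists I, J; split=> [u|v z]; first by rewrite I1 J1.
by rewrite I2 J2; have [->] := I1 (inl v).
Qed.

Lemma cover_isob_sym (R : realType) (d : nat) (Y Z : finType)
  (P : portrait d Y Z) : symmetric (@cover_isob R d Y Z P).
Proof.
suff half (F1 F2 : RatHat R P) : tree_cover_iso F1 F2 -> tree_cover_iso F2 F1.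
  by move=> F1 F2; apply/asboolP/asboolP => /half.
case=> I [J [IJ1 IJ2]].
have [I' [I1 I2 I3 I4]] := stree_iso_sym I.
have [J' [J1 J2 J3 J4]] := stree_iso_sym J.
exists I', J'; split=> [u|v z].
  by rewrite -{1}[u]I2 -IJ1 J1.
have I5 : tm_int (si_map I) (tm_int (si_map I') v) = v by have [] := I2 (inl v).
have zE : si_mob I (tm_int (si_map I') v) (si_mob I' v z) = z.
  apply: (can_inj (mob_invK (si_mob I' v))).
  by have := I4 (tm_int (si_map I') v) (si_mob I' v z); rewrite I5.
rewrite -[in RHS]zE -[in tc_fun F2 _]I5 IJ2.
have -> : tm_int (tc_map F2) v =
    tm_int (si_map J) (tm_int (tc_map F1) (tm_int (si_map I') v)).
  by have [] := IJ1 (inl (tm_int (si_map I') v)); rewrite I5.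
by rewrite J4.
Qed.

Lemma cover_isob_trans (R : realType) (d : nat) (Y Z : finType)
  (P : portrait d Y Z) : transitive (@cover_isob R d Y Z P).
Proof.
move=> F2 F1 F3 /asboolP[I [J [IJ1 IJ2]]] /asboolP[I' [J' [IJ1' IJ2']]].
apply/asboolP.
have [K [K1 K2 K3]] := stree_iso_trans I I'.
have [L [L1 L2 L3]] := stree_iso_trans J J'.
exists K, L; split=> [u|v z]; first by rewrite K1 L1 IJ1 IJ1'.
rewrite K2 K3 L3 IJ2' IJ2.
by have [->] := IJ1 (inl v).
Qed.

HB.instance Definition _ (R : realType) (d : nat) (Y Z : finType)
  (P : portrait d Y Z) := gen_eqMixin (RatHat R P).
HB.instance Definition _ (R : realType) (d : nat) (Y Z : finType)
  (P : portrait d Y Z) := gen_choiceMixin (RatHat R P).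

Canonical cover_equiv (R : realType) (d : nat) (Y Z : finType)
    (P : portrait d Y Z) :=
  EquivRel (@cover_isob R d Y Z P) (@cover_isob_refl R d Y Z P)
    (@cover_isob_sym R d Y Z P) (@cover_isob_trans R d Y Z P).

Definition RatHatClass (R : realType) (d : nat) (Y Z : finType)
    (P : portrait d Y Z) := {eq_quot @cover_isob R d Y Z P}%qT.

Definition cover_class (R : realType) (d : nat) (Y Z : finType)
    (P : portrait d Y Z) (F : RatHat R P) : RatHatClass R P :=
  (\pi_({eq_quot @cover_isob R d Y Z P}) F)%qT.

Definition Imap (R : realType) (d : nat) (Y Z : finType)
    (P : portrait d Y Z) (c : RatHatClass R P) : ModHat R Y :=
  mod_class (tc_src (repr (c : {eq_quot @cover_isob R d Y Z P}%qT))).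

Lemma ImapE (R : realType) (d : nat) (Y Z : finType)
    (P : portrait d Y Z) (F : RatHat R P) :
  Imap (cover_class F) = mod_class (tc_src F).
Proof.
apply/eqmodP; apply/asboolP.
have /eqmodP/asboolP[I _] : cover_class (repr (cover_class F : {eq_quot @cover_isob R d Y Z P}%qT)) = cover_class F.
  exact: reprK.
by exists.
Qed.

Definition locally_uniform_cvg (S : topologicalType) (V : uniformType)
    (g : nat -> S -> V) (f : S -> V) (A : set S) : Prop :=
  forall x, A x -> exists2 U, nbhs x U & {uniform U, g @ \oo --> f}.

Definition ts_converges (R : realType) (d : nat) (Y Z : finType)
    (P : portrait d Y Z) (Fn : nat -> RatF R P) (F : RatHat R P) : Prop :=
  forall v : 'I_(nint (tc_src F)), let w := tm_int (tc_map F) v in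
  exists phiY phiZ : nat -> mobius R,
    [/\ forall y, (fun n => phiY n (rf_aY (Fn n) y)) @ \oo --> marking v y,
        forall z, (fun n => phiZ n (rf_aZ (Fn n) z)) @ \oo --> marking w z &
        locally_uniform_cvg
          (fun n => phiZ n \o rf_fun (Fn n) \o mob_inv (phiY n) : P1 R -> P1 R)
          (tc_fun F v) (~` marked_points v)].

(* Main.v *)
From mathcomp Require Import all_boot all_order all_algebra.
From mathcomp Require Import generic_quotient complex ring lra zify.
From mathcomp Require Import all_classical all_reals all_analysis.
Require Import Defs.
Set Implicit Arguments.
Unset Strict Implicit.
Unset Printing Implicit Defensive.
Import Order.TTheory GRing.Theory Num.Theory numFieldNormedType.Exports.
Local Open Scope classical_set_scope.
Local Open Scope ring_scope.

(**
Write T^Y, T^Z for the trees of the limit cover, F for the map between them,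
f_v for its map at v, and lift points of the projective line to vectors of C^2,
so that [wedge x a] is the linear form in x that vanishes at the point a.

From convergence of covers to convergence of the sources. The coordinate
alpha_t(x) of a tree of spheres is the cross-ratio of four marked points on the
sphere S_v, where v = v_t. Cross-ratios are invariant under Moebius
transformations and continuous as long as the three reference points stay
distinct, and in the limit phi^Y_(n,v) carries the marked points of F_n to those
of S_v. Here it matters that v_t exists and is unique ([tripod_exists],
[tripod_uniq]).

From convergence of the sources to convergence of covers. Fix v and w = F(v).
A triple t with v_t = v normalizes the sources: this gives phi^Y_n with
phi^Y_n(a_n(y)) -> a_v(y) for all y ([source_rescaling]). The point is that the
marked source then determines the whole cover, because a portrait marks entire
fibres over Z. Put

  Phi_z(x) = product over y in the fibre of z of (wedge x a(y))^(deg y),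

a form of degree d in x. For a single rational map f, these forms for z in Z are,
up to constants, the members of the pencil of f over the marked points of the
target. Hence f is [Phi_z0 : Phi_z1] up to a Moebius transformation, and the
marked point of z can be read off from the position of Phi_z in the pencil.

The same holds for f_v at a vertex v of a tree, although a_v collapses each
branch of T^Y at v to a point and f_v need not have degree d: the Phi_z acquire
a common divisor, and dividing by it leaves the pencil of f_v
([fiber_form_lift]). This is a count of exponents, branch by branch. For two
leaves z, z' of T^Z, send a unit flow from z' to z, and pull it back to T^Y,
multiplying by the degree of each edge. At an internal vertex of T^Y the result
is again conserved, since the degrees above each edge at F(v) have the same sum,
the degree of f_v ([cover_fiber], [pulled_flow_int]). So the flow entering a
branch equals the total that its leaves absorb ([flow_branch]), which says that
the number of preimages of z minus that of z', in the branch of an edge e at v,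
is deg e times the same difference for the edge F(e) at w ([flow_identity]).

Choosing z0, z1 in different directions at w makes Phi_z0, Phi_z1 a basis of the
pencil in the limit. Both f_v and f_n are then given by the same formula
([cover_formula]), with the points a_v(y) and phi^Y_n(a_n(y)) respectively. The
formula is continuous in these points, uniformly in x away from the zeros of
Phi_z0 and Phi_z1, that is, locally uniformly outside Y_v. For phi^Z_n, compose
the Moebius transformation that the formula provides for f_n with the inverse of
the one that it provides for f_v ([ts_converges_of_Imap_cvg]).
*)

(** * Branches of a tree *)

Lemma connect_closed (V : finType) (e : rel V) (P : pred V) (a b : V) :
  (forall x y, P x -> e x y -> P y) -> P a -> connect e a b -> P b.
Proof.
move=> Pe Pa /connectP[p pp ->]; elim: p a Pa pp => //= c p IH a Pa /andP[ac pp].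
exact: IH (Pe _ _ Pa ac) pp.
Qed.

Section TreeBranches.
Variables (X : finType) (T : ctree X).
Implicit Types a b c u v : vertex T.

Definition cut a b : rel (vertex T) :=
  [rel x y | adj x y && ~~ (((x == a) && (y == b)) || ((x == b) && (y == a)))].

(** Removing the edge rather than the vertex [a] treats leaves and internal
vertices alike, and makes the two sides of an edge complementary. *)
Definition branch a b c := connect (cut a b) b c.

(** The relation behind [connect_off], at an arbitrary vertex. *)
Definition off v : rel (vertex T) := [rel x y | [&& adj x y, x != v & y != v]].

Lemma cut_sym a b : symmetric (cut a b).
Proof.
move=> x y; rewrite /cut /= adj_sym; congr (_ && ~~ _).
by rewrite orbC [(x == b) && _]andbC [(x == a) && _]andbC.
Qed.

Lemma cutC a b : cut a b =2 cut b a.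
Proof. by move=> x y; rewrite /cut /= orbC. Qed.

Lemma off_sym v : symmetric (off v).
Proof. by move=> x y; rewrite /off /= adj_sym [(x != v) && _]andbC. Qed.

(** A second path from [a] to [b] would close up to a cycle. *)
Lemma bridge a b : adj a b -> ~~ branch a b a.
Proof.
move=> ab; apply/negP; rewrite /branch (sym_connect_sym (cut_sym a b)).
case/connectP=> p0 p0p bE; move: bE; case/shortenP: p0p => p pp up _ bE.
have ppa : path (@adj _ T) a p by apply: sub_path pp => x y /andP[].
have cyc : ucycle (@adj _ T) (a :: p).
  by rewrite /ucycle /= rcons_path ppa -bE adj_sym ab.
have := adj_acyclic cyc.
case: p pp up bE {ppa cyc} => [|w [|//]] /=.
  by move=> _ _ e; rewrite e adj_irr in ab.
by rewrite andbT => + _ e; rewrite -e /cut /= !eqxx /= andbF.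
Qed.

Lemma branch_step a b c c' : branch a b c -> adj c c' ->
  branch a b c' || ((c == b) && (c' == a)).
Proof.
move=> bc cc'; have [cutc|] := boolP (cut a b c c').
  by rewrite /branch (connect_trans bc (connect1 cutc)).
rewrite /cut /= cc' /= negbK => /orP[/andP[_ /eqP->]|->]; last by rewrite orbT.
by rewrite /branch connect0.
Qed.

(** Only the removed edge leads from one side to the other. *)
Lemma branchC a b c : adj a b -> branch b a c = ~~ branch a b c.
Proof.
move=> ab; apply/idP/idP => [bac|].
  apply/negP => abc; have := bridge ab; rewrite /branch.
  rewrite (connect_trans abc) // (sym_connect_sym (cut_sym a b)).
  by rewrite (eq_connect (cutC a b)).
have : branch b a c || branch a b c.
  apply: (@connect_closed _ (@adj _ T) (fun c => branch b a c || branch a b c) a);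
    last exact: adj_connected.
    move=> x y /orP[] h xy.
      have /orP[->//|/andP[_ /eqP->]] := branch_step h xy.
      by rewrite /branch connect0 orbT.
    have /orP[->|/andP[_ /eqP->]] := branch_step h xy; first by rewrite orbT.
    by rewrite /branch connect0.
  by rewrite /branch connect0.
by case/orP=> // ->.
Qed.

Lemma branch_neq a b c : adj a b -> branch a b c -> c != a.
Proof. by move=> ab; apply: contraL => /eqP->; exact: bridge. Qed.

Lemma branchxx a b : branch a b b.
Proof. exact: connect0. Qed.

Lemma off_cut v u x y : connect (off v) x y -> connect (cut v u) x y.
Proof.
apply: connect_sub => p q /and3P[pq pv qv]; apply: connect1.
by rewrite /cut /= pq (negPf pv) (negPf qv) andbF.
Qed.

(** A path that avoids the edge from [v] to [u] but passes through [v] would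
contradict [bridge]. *)
Lemma branch_off v u c : adj v u -> branch v u c = connect (off v) u c.
Proof.
move=> vu; apply/idP/idP; last exact: off_cut.
move=> h; have : branch v u c && connect (off v) u c; last by case/andP.
apply: (@connect_closed _ (cut v u) (fun c => branch v u c && connect (off v) u c) u c _ _ h);
  last by rewrite /branch !connect0.
move=> x y /andP[bx cx] xy.
have by' : branch v u y by exact: connect_trans bx (connect1 xy).
rewrite by' /=; apply: connect_trans cx (connect1 _).
by rewrite /off /= (branch_neq vu bx) (branch_neq vu by') !andbT; case/andP: xy.
Qed.

(** Distinct neighbours of [v] lead to disjoint branches: otherwise the edge
towards the first one could be bypassed through the second. *)
Lemma branch_uniq v u u' c : adj v u -> adj v u' ->
  branch v u c -> branch v u' c -> u = u'.
Proof.
move=> vu vu'; rewrite !branch_off // => uc u'c; apply/eqP/negPn/negP => uu'.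
have := bridge vu'; rewrite /branch.
rewrite (sym_connect_sym (off_sym v)) in uc.
have /(off_cut u') h := connect_trans u'c uc; rewrite (connect_trans h) //.
apply: connect1; rewrite /cut /= adj_sym vu (negPf uu') /= orbF.
apply/negP => /andP[/eqP e _]; by rewrite e adj_irr in vu.
Qed.

Lemma branch_exists v c : c != v -> exists2 u, adj v u & branch v u c.
Proof.
move=> cv.
have : (c == v) || [exists u, adj v u && branch v u c].
  apply: (@connect_closed _ (@adj _ T)
    (fun c => (c == v) || [exists u, adj v u && branch v u c]) v);
    rewrite ?eqxx //; last exact: adj_connected.
  move=> x y /orP[/eqP->|/existsP[u /andP[vu bx]]] xy.
    by apply/orP; right; apply/existsP; exists y; rewrite xy branchxx.
  have /orP[by'|/andP[_ ->//]] := branch_step bx xy.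
  by apply/orP; right; apply/existsP; exists u; rewrite vu by'.
by rewrite (negPf cv) => /existsP[u /andP[]]; exists u.
Qed.

(** A path inside the branch avoids [v], hence stays in the branch at [v] that
contains its starting point. *)
Lemma branch_sub v d v' c x : branch v d v' -> adj v' c -> ~~ branch v' c v ->
  branch v' c x -> branch v d x.
Proof.
move=> dv' v'c ncv h.
have step y y' : branch v d y -> branch v' c y' -> adj y y' -> branch v d y'.
  move=> dy cy' yy'; have /orP[//|/andP[_ /eqP e]] := branch_step dy yy'.
  by rewrite -e cy' in ncv.
have : branch v' c x && branch v d x; last by case/andP.
apply: (@connect_closed _ (cut v' c)
  (fun y => branch v' c y && branch v d y) c x _ _ h).
  move=> y y' /andP[cy dy] yy'.
  have cy' : branch v' c y' by exact: connect_trans cy (connect1 yy').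
  by rewrite cy' (step y) //; case/andP: yy'.
by rewrite branchxx (step v') ?branchxx.
Qed.

Lemma branch_no_return a b c : adj a b -> adj b c -> c != a -> ~~ branch b c a.
Proof.
move=> ab bc; apply: contra => bca; rewrite adj_sym in ab.
by rewrite (branch_uniq bc ab bca (branchxx b a)).
Qed.

Lemma branch_sub_proper a b c : adj a b -> adj b c -> c != a ->
  (#|[pred x | branch b c x]| < #|[pred x | branch a b x]|)%N.
Proof.
move=> ab bc ca; apply: proper_card; apply/properP; split.
  apply/fintype.subsetP => x; rewrite !inE.
  exact: branch_sub (branchxx a b) bc (branch_no_return ab bc ca).
by exists b; rewrite !inE ?branchxx // bridge.
Qed.

Lemma leaf_adj_uniq (x : X) b b' :
  adj (inr x : vertex T) b -> adj (inr x : vertex T) b' -> b = b'.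
Proof.
move=> xb xb'; have /card_le1_eqP := eq_leq (@adj_leaf _ T x).
by apply.
Qed.

Lemma leaf_branch (x : X) b c : adj b (inr x : vertex T) ->
  branch b (inr x : vertex T) c = (c == inr x).
Proof.
move=> bx; apply/idP/eqP => [h|->]; last exact: branchxx.
apply/eqP; apply: (@connect_closed _ (cut b (inr x)) (fun c => c == inr x) (inr x) c _ _ h);
  last exact: eqxx.
move=> y y' /eqP-> /andP[xy]; rewrite adj_sym in bx.
by rewrite (leaf_adj_uniq bx xy) !eqxx orbT.
Qed.

Lemma leaf_cobranch (x : X) b c : adj (inr x : vertex T) b ->
  branch (inr x : vertex T) b c = (c != inr x).
Proof. by move=> xb; rewrite branchC 1?adj_sym // leaf_branch // adj_sym. Qed.

(** Two adjacent leaves would form a whole component; the vertex [v0] rules this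
out. *)
Lemma leaf_adj_int (v0 : 'I_(nint T)) (x : X) b : adj (inr x : vertex T) b ->
  exists v : 'I_(nint T), b = inl v.
Proof.
case: b => [v|y] xy; first by exists v.
have : (inl v0 : vertex T) \in pred2 (inr x) (inr y).
  apply: (@connect_closed _ (@adj _ T) (mem (pred2 (inr x) (inr y))) (inr x));
    rewrite ?inE ?eqxx //; last exact: adj_connected.
  move=> a b; rewrite !inE => /orP[]/eqP-> ab.
    by rewrite (leaf_adj_uniq ab xy) eqxx orbT.
  by rewrite adj_sym in xy; rewrite (leaf_adj_uniq ab xy) eqxx.
by rewrite !inE.
Qed.

Lemma toward_spec (v : 'I_(nint T)) (x : X) :
  adj (inl v) (toward v x) /\ branch (inl v) (toward v x) (inr x).
Proof.
rewrite /toward; case: pickP => [u /andP[vu h]|none] /=.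
  by split=> //; rewrite branch_off.
have [//|u vu bx] := @branch_exists (inl v) (inr x).
by have /negP[] := none u; rewrite vu /=; rewrite branch_off // in bx.
Qed.

Lemma toward_adj (v : 'I_(nint T)) (x : X) : adj (inl v) (toward v x).
Proof. by case: (toward_spec v x). Qed.

Lemma toward_branch (v : 'I_(nint T)) (x : X) :
  branch (inl v) (toward v x) (inr x).
Proof. by case: (toward_spec v x). Qed.

Lemma towardE (v : 'I_(nint T)) u (x : X) : adj (inl v) u ->
  branch (inl v) u (inr x) = (toward v x == u).
Proof.
move=> vu; apply/idP/eqP => [h|<-]; last exact: toward_branch.
exact: branch_uniq (toward_adj v x) vu (toward_branch v x) h.
Qed.

(** Internal vertices have valence at least 3, so a branch can be followed
outwards, through smaller and smaller branches, until a leaf is met. *)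
Lemma branch_has_leaf a b : adj a b -> exists x : X, branch a b (inr x).
Proof.
have [n] := ubnP #|[pred x | branch a b x]|; elim: n a b => // n IH a b.
rewrite ltnS => le ab; case: b => [v|x] in ab le *; last first.
  by exists x; exact: branchxx.
have /card_gt1P[c [c' [vc vc' cc']]] : (1 < #|adj (inl v : vertex T)|)%N.
  by apply: leq_trans (adj_internal v).
have [d vd da] : exists2 d, adj (inl v : vertex T) d & d != a.
  have [e|ca] := eqVneq c a; last by exists c.
  by exists c' => //; rewrite -e eq_sym.
have [x bx] := IH _ _ (leq_trans (branch_sub_proper ab vd da) le) vd.
exists x; exact: branch_sub (branchxx a _) vd (branch_no_return ab vd da) bx.
Qed.

Lemma toward_surj (v : 'I_(nint T)) u : adj (inl v) u ->
  exists x : X, toward v x = u.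
Proof.
move=> vu; have [x] := branch_has_leaf vu.
by rewrite towardE // => /eqP; exists x.
Qed.

(** The vertex is the end [b] of a minimal branch [branch a b] that contains [x0]
and [x1] but not [x2]: if [x0] and [x1] lay in the same direction at [b], the
branch in that direction would be smaller. *)
Lemma tripod_exists (x0 x1 x2 : X) : x0 != x1 -> x0 != x2 -> x1 != x2 ->
  exists v : 'I_(nint T), uniq [:: toward v x0; toward v x1; toward v x2].
Proof.
move=> x01 x02 x12.
have descent a b : adj a b -> branch a b (inr x0) -> branch a b (inr x1) ->
    ~~ branch a b (inr x2) ->
    exists v : 'I_(nint T), uniq [:: toward v x0; toward v x1; toward v x2].
  have [n] := ubnP #|[pred x | branch a b x]|; elim: n a b => // n IH a b.
  rewrite ltnS => le ab b0 b1 b2; case: b => [v|x] in ab le b0 b1 b2 *; last first.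
    move: b0 b1; rewrite !leaf_branch // => /eqP[e0] /eqP[e1].
    by rewrite e0 e1 eqxx in x01.
  have va : adj (inl v) a by rewrite adj_sym.
  have t2 : toward v x2 = a by apply/eqP; rewrite -towardE // branchC.
  have na x : branch a (inl v) (inr x) -> toward v x != a.
    by move=> bx; rewrite -towardE // branchC // bx.
  have [e|ne] := eqVneq (toward v x0) (toward v x1); last first.
    by exists v; rewrite /= !inE t2 negb_or ne !na.
  apply: (IH (inl v) (toward v x0)).
  - exact: leq_trans (branch_sub_proper ab (toward_adj v x0) (na _ b0)) le.
  - exact: toward_adj.
  - exact: toward_branch.
  - by rewrite e toward_branch.
  - by rewrite towardE ?toward_adj // t2 eq_sym na.
have [b] : exists b, adj (inr x2 : vertex T) b.
  have /card_gt0P[b x2b] : (0 < #|adj (inr x2 : vertex T)|)%N by rewrite adj_leaf.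
  by exists b.
move=> x2b; apply: (descent (inr x2) b) => //.
- by rewrite leaf_cobranch //; apply: contra x02 => /eqP[->].
- by rewrite leaf_cobranch //; apply: contra x12 => /eqP[->].
- by rewrite leaf_cobranch // eqxx.
Qed.

(** Seen from [v], all leaves that are not in the direction of [v] at [v'] lie in
one direction, namely that of [v']; this applies to at least two of the three. *)
Lemma tripod_uniq (v v' : 'I_(nint T)) (x0 x1 x2 : X) :
  uniq [:: toward v x0; toward v x1; toward v x2] ->
  uniq [:: toward v' x0; toward v' x1; toward v' x2] -> v = v'.
Proof.
move=> uv uv'; apply/eqP/negPn/negP => vv'.
have ne : (inl v' : vertex T) != inl v by apply: contra vv' => /eqP[->].
have [d vd dv'] := branch_exists ne.
rewrite eq_sym in ne; have [d' v'd' d'v] := branch_exists ne.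
have key x : toward v' x != d' -> toward v x = d.
  move=> nd; apply/eqP; rewrite -towardE //.
  apply: branch_sub dv' (toward_adj v' x) _ (toward_branch v' x).
  apply/negP => h; have := branch_uniq (toward_adj v' x) v'd' h d'v.
  by move/eqP; rewrite (negPf nd).
move: uv uv'; rewrite /= !inE !negb_or !andbT.
case/andP=> /andP[n01 n02] n12 /andP[/andP[m01 m02] m12].
have [e0|/key e0] := eqVneq (toward v' x0) d'.
  have /key e1 : toward v' x1 != d' by rewrite -e0 eq_sym.
  have /key e2 : toward v' x2 != d' by rewrite -e0 eq_sym.
  by rewrite e1 e2 eqxx in n12.
have [e1|/key e1] := eqVneq (toward v' x1) d'.
  have /key e2 : toward v' x2 != d' by rewrite -e1 eq_sym.
  by rewrite e0 e2 eqxx in n02.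
by rewrite e0 e1 eqxx in n01.
Qed.

Lemma tripodE (v : 'I_(nint T)) (x0 x1 x2 : X) :
  uniq [:: toward v x0; toward v x1; toward v x2] -> tripod T x0 x1 x2 = Some v.
Proof.
move=> uv; rewrite /tripod; case: pickP => [v' uv'|/(_ v)]; last by rewrite uv.
by rewrite (tripod_uniq uv uv').
Qed.

Lemma tripod_of_vertex (v : 'I_(nint T)) : exists x0 x1 x2,
  uniq [:: toward v x0; toward v x1; toward v x2].
Proof.
have /card_gt2P[u0 [u1 [u2 [[v0 v1 v2] [n01 n12 n20]]]]] := adj_internal v.
have [x0 e0] := toward_surj v0; have [x1 e1] := toward_surj v1.
have [x2 e2] := toward_surj v2; exists x0, x1, x2.
by rewrite e0 e1 e2 /= !inE negb_or n01 n12 eq_sym n20.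
Qed.

End TreeBranches.

(** * Homogeneous coordinates on the projective line *)

Section ProjectiveLine.
Variable R : realType.
Local Notation C := R[i].
Implicit Types (x y : C * C) (p q : P1 R) (m : mobius R).

Definition wedge x y : C := x.1 * y.2 - x.2 * y.1.
Definition hp x : P1 R := hproj x.1 x.2.
Definition hlift p : C * C := if p is Some w then (w, 1) else (1, 0).
Definition nonzero x := (x.1 != 0) || (x.2 != 0).

Lemma lift_nonzero p : nonzero (hlift p).
Proof. by rewrite /nonzero; case: p => [w|] /=; rewrite oner_eq0 ?orbT. Qed.

Lemma hp_lift p : hp (hlift p) = p.
Proof. by rewrite /hp /hproj; case: p => [w|] /=; rewrite ?oner_eq0 ?eqxx ?divr1. Qed.

Definition scale (k : C) x : C * C := (k * x.1, k * x.2).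

Lemma hp_scale k x : k != 0 -> hp (scale k x) = hp x.
Proof. exact: hproj_scale. Qed.

Lemma nonzero_scale k x : k != 0 -> nonzero x -> nonzero (scale k x).
Proof. by move=> k0; rewrite /nonzero /= !mulf_eq0 (negPf k0). Qed.

Lemma hp_lift_scale x : nonzero x -> exists2 k, k != 0 & x = scale k (hlift (hp x)).
Proof.
rewrite /nonzero /hp /hproj /scale; case: x => a b /=; have [->|b0] := eqVneq b 0.
  by rewrite orbF => a0; exists a => //=; rewrite mulr1 mulr0.
by move=> _; exists b => //=; rewrite mulr1 mulrC divfK.
Qed.

Lemma wedge_scalel k x y : wedge (scale k x) y = k * wedge x y.
Proof. by rewrite /wedge /=; ring. Qed.
Lemma wedge_scaler k x y : wedge x (scale k y) = k * wedge x y.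
Proof. by rewrite /wedge /=; ring. Qed.
Lemma wedgexx x : wedge x x = 0.
Proof. by rewrite /wedge; ring. Qed.

Lemma wedge_lift_eq0 p q : (wedge (hlift p) (hlift q) == 0) = (p == q).
Proof.
rewrite /wedge; case: p q => [a|] [b|] /=.
- by rewrite mulr1 mul1r subr_eq0.
- by rewrite mulr0 mulr1 sub0r oppr_eq0 oner_eq0.
- by rewrite mulr1 mul0r subr0 oner_eq0.
- by rewrite mulr0 mul0r subrr !eqxx.
Qed.

Lemma wedge_eq0 x y : nonzero x -> nonzero y ->
  (wedge x y == 0) = (hp x == hp y).
Proof.
move=> /hp_lift_scale[k k0 {1}->] /hp_lift_scale[l l0 {1}->].
by rewrite wedge_scalel wedge_scaler !mulf_eq0 (negPf k0) (negPf l0) wedge_lift_eq0.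
Qed.

Definition mact (m : mobius R) x : C * C :=
  (mob_a m * x.1 + mob_b m * x.2, mob_c m * x.1 + mob_d m * x.2).
Definition mdet (m : mobius R) := mob_a m * mob_d m - mob_b m * mob_c m.

Lemma mdet_neq0 m : mdet m != 0. Proof. exact: mob_det. Qed.

Lemma mob_hp m x : nonzero x -> m (hp x) = hp (mact m x).
Proof. exact: mob_hproj. Qed.

Lemma mact_nonzero m x : nonzero x -> nonzero (mact m x).
Proof. exact: hproj_lin_neq0. Qed.

Lemma wedge_mact m x y : wedge (mact m x) (mact m y) = mdet m * wedge x y.
Proof. by rewrite /wedge /mact /mdet /=; ring. Qed.

Lemma mob_inj m : injective m.
Proof. exact: can_inj (mob_invK m). Qed.

End ProjectiveLine.

(** * Fibres of a rational map *)

Section RationalMaps.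
Variable R : realType.
Local Notation C := R[i].
Implicit Types (x y : C * C) (p q : P1 R) (f : ratmap R).

(** The form of degree [n] whose dehomogenization is [h]; its extra zeros, when
[size h <= n], are at infinity. *)
Definition hform (n : nat) (h : {poly C}) x : C :=
  \sum_(i < n.+1) h`_i * x.1 ^+ i * x.2 ^+ (n - i).

Lemma hformE n (h : {poly C}) x : (size h <= n.+1)%N -> x.2 != 0 ->
  hform n h x = x.2 ^+ n * h.[x.1 / x.2].
Proof.
move=> le x20; rewrite (horner_coef_wide _ le) mulr_sumr; apply: eq_bigr => i _.
have -> : x.2 ^+ n = x.2 ^+ (n - i) * x.2 ^+ i.
  by rewrite -exprD subnK // -ltnS.
by rewrite expr_div_n; field; rewrite expf_neq0.
Qed.

Lemma hform_inf n (h : {poly C}) a : hform n h (a, 0) = h`_n * a ^+ n.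
Proof.
rewrite /hform big_ord_recr /= subnn expr0 mulr1 big1 ?add0r // => i _.
by rewrite expr0n subn_eq0 leqNgt ltn_ord mulr0.
Qed.

Lemma hformB n (h g : {poly C}) c x :
  hform n (h - c *: g) x = hform n h x - c * hform n g x.
Proof.
rewrite /hform mulr_sumr -sumrB; apply: eq_bigr => i _.
by rewrite coefB coefZ; ring.
Qed.

Lemma hform_prod n (r : seq C) (c : C) x : (size r <= n)%N ->
  hform n (c *: \prod_(z <- r) ('X - z%:P)) x =
  c * \prod_(z <- r) (x.1 - z * x.2) * x.2 ^+ (n - size r).
Proof.
move=> le; have [x20|x20] := eqVneq x.2 0; last first.
  rewrite hformE //; last first.
    by rewrite (leq_trans (size_scale_leq _ _)) // size_prod_XsubC.
  rewrite hornerZ horner_prod.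
  have -> : \prod_(z <- r) (x.1 - z * x.2) =
      \prod_(z <- r) ('X - z%:P).[x.1 / x.2] * x.2 ^+ size r.
    elim: r {le} => [|z r IH]; first by rewrite !big_nil mul1r.
    by rewrite !big_cons IH /= hornerXsubC exprS; field.
  have -> : x.2 ^+ n = x.2 ^+ (n - size r) * x.2 ^+ size r by rewrite -exprD subnK.
  by ring.
case: x x20 => a b /= ->; rewrite hform_inf coefZ.
have -> : \prod_(z <- r) (a - z * 0) = a ^+ size r.
  elim: r {le} => [|z r IH]; first by rewrite big_nil.
  by rewrite big_cons IH mulr0 subr0 exprS.
have [e|ne] := eqVneq (size r) n.
  have /monicP := monic_prod_XsubC r xpredT id.
  rewrite lead_coefE size_prod_XsubC /= => m1.
  by rewrite -e subnn expr0 m1 !mulr1.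
have lt : (size r < n)%N by rewrite ltn_neqAle ne.
rewrite nth_default ?size_prod_XsubC // expr0n subn_eq0 leqNgt lt /=.
by rewrite !mulr0 mul0r.
Qed.

Lemma mup_prod_XsubC (r : seq C) w :
  mup w (\prod_(z <- r) ('X - z%:P)) = count_mem w r.
Proof.
elim: r => [|z r IH]; first by rewrite big_nil mupNroot // root1.
rewrite big_cons mupM ?polyXsubC_eq0 ?monic_neq0 ?monic_prod_XsubC //.
by rewrite IH /= -['X - z%:P]expr1 mup_XsubCX; case: eqP.
Qed.

Lemma mupZ (c : C) (h : {poly C}) w : c != 0 -> mup w (c *: h) = mup w h.
Proof. by move=> c0; rewrite -mul_polyC mupMr // rootC. Qed.

Lemma rm_fiber_neq0 f q : rm_fiber f q != 0.
Proof.
have := rm_coprime f; have := rm_nonconst f; rewrite /rm_fiber.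
move: (rm_num f) (rm_den f) => a b nc cop; apply/eqP; case: q => [c e|e].
  have ae : a = c *: b by apply/eqP; rewrite -subr_eq0 e.
  have b1 : size b = 1%N.
    move: cop; rewrite ae; have [->|c0] := eqVneq c 0.
      by rewrite scale0r coprime0p -size_poly_eq1 => /eqP.
    by rewrite coprimepZl // coprimepp => /eqP.
  by move: nc; rewrite ae leq_max b1 orbF ltnNge -b1 size_scale_leq.
move: cop nc; rewrite e coprimep0 -size_poly_eq1 => /eqP ->.
by rewrite leq_max size_poly0.
Qed.

Lemma rm_degree_size f : (size (rm_num f) <= (rm_degree f).+1)%N /\
  (size (rm_den f) <= (rm_degree f).+1)%N.
Proof.
have := rm_nonconst f; rewrite /rm_degree; case E : maxn => [//|n] _ /=.
by rewrite -E leq_maxl leq_maxr.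
Qed.

Lemma rm_fiber_size f q : (size (rm_fiber f q) <= (rm_degree f).+1)%N.
Proof.
have [sn sd] := rm_degree_size f; case: q => [c|] //=.
rewrite (leq_trans (size_polyD _ _)) // geq_max sn size_polyN.
exact: leq_trans (size_scale_leq _ _) sd.
Qed.

Lemma rm_top f : ((rm_num f)`_(rm_degree f) != 0) || ((rm_den f)`_(rm_degree f) != 0).
Proof.
have nc := rm_nonconst f; rewrite /rm_degree.
have top (h : {poly C}) : (1 < size h)%N -> h`_(size h).-1 != 0.
  by move=> h1; rewrite -lead_coefE lead_coef_eq0 -size_poly_gt0 ltnW.
case/orP: (leq_total (size (rm_num f)) (size (rm_den f))) => le; move: nc.
  by rewrite (maxn_idPr le) => /top ->; rewrite orbT.
by rewrite (maxn_idPl le) => /top ->.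
Qed.

Lemma rm_num_den f w : ((rm_num f).[w] != 0) || ((rm_den f).[w] != 0).
Proof.
have [d0|//] := eqVneq (rm_den f).[w] 0; last by rewrite orbT.
have cop := rm_coprime f; rewrite orbF; apply/negP => /eqP n0.
have := coprimep_root cop (x := w); rewrite /root n0 d0 eqxx => /(_ isT).
by [].
Qed.

Lemma rm_fun_fiber f (q p : P1 R) : (f p == q) =
  if p is Some w then root (rm_fiber f q) w
  else (rm_fiber f q)`_(rm_degree f) == 0.
Proof.
case: p => [w|] /=.
  have := rm_num_den f w; rewrite /rm_fiber; case: (eqVneq (rm_den f).[w] 0) => [d0|d0] /=.
    rewrite orbF => n0; case: q => [c|]; last by rewrite /root d0 !eqxx.
    by rewrite rootE !hornerE d0 mulr0 subr0 (negPf n0).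
  move=> _; case: q => [c|]; last by rewrite /root (negPf d0).
  rewrite rootE !hornerE subr_eq0; apply/eqP/eqP => [[<-]|->].
    by rewrite divfK.
  by rewrite mulfK.
have := rm_top f; rewrite /rm_fiber; case: (eqVneq (rm_den f)`_(rm_degree f) 0) => [d0|d0] /=.
  rewrite orbF => n0; case: q => [c|]; last by rewrite d0 !eqxx.
  by rewrite coefB coefZ d0 mulr0 subr0 (negPf n0).
move=> _; case: q => [c|]; last by rewrite (negPf d0).
rewrite coefB coefZ subr_eq0; apply/eqP/eqP => [[<-]|->].
  by rewrite divfK.
by rewrite mulfK.
Qed.

(** A lift of [f] to a homogeneous map of C^2. *)
Definition rm_lift f x : C * C :=
  (hform (rm_degree f) (rm_num f) x, hform (rm_degree f) (rm_den f) x).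

Lemma rm_hp f x : nonzero x -> f (hp x) = hp (rm_lift f x).
Proof.
have [sn sd] := rm_degree_size f.
rewrite /nonzero /rm_lift /hp /hproj; case: x => a b; have [->|b0] := eqVneq b 0.
  rewrite orbF /= => a0; rewrite !hform_inf mulf_eq0 expf_eq0 (negPf a0) andbF orbF.
  case: eqP => // _; congr Some.
  by rewrite -mulf_div divff ?mulr1 // expf_neq0.
move=> _ /=; rewrite !hformE //= mulf_eq0 expf_eq0 (negPf b0) andbF /=.
by case: eqP => // _; congr Some; rewrite -[RHS]mulf_div divff ?mul1r // expf_neq0.
Qed.

Lemma rm_lift_nonzero f x : nonzero x -> nonzero (rm_lift f x).
Proof.
have [sn sd] := rm_degree_size f.
rewrite /nonzero /rm_lift; case: x => a b; have [->|b0] := eqVneq b 0.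
  rewrite orbF /= => a0; rewrite !hform_inf !mulf_eq0 expf_eq0 (negPf a0) andbF !orbF.
  exact: rm_top.
move=> _ /=; rewrite !hformE //= !mulf_eq0 expf_eq0 (negPf b0) andbF /=.
exact: rm_num_den.
Qed.

(** The field is algebraically closed, so [rm_fiber f q] is a product of linear
factors, whose exponents are the local degrees at the finite points of the fibre.
Its degree falls short of [rm_degree f] by the local degree at infinity. *)
Lemma fiber_factor f q (s : seq (P1 R)) : uniq s ->
  (forall p, (p \in s) = (f p == q)) ->
  (\sum_(p <- s) local_degree f p = rm_degree f)%N /\
  exists2 k : C, k != 0 & forall x,
    wedge (rm_lift f x) (hlift q) = k * \prod_(p <- s) wedge x (hlift p) ^+ local_degree f p.
Proof.
move=> us sP; pose n := rm_degree f; pose h := rm_fiber f q.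
have h0 : h != 0 by exact: rm_fiber_neq0.
have [r hE] := closed_field_poly_normal h.
have c0 : lead_coef h != 0 by rewrite lead_coef_eq0.
have sh : size h = (size r).+1 by rewrite hE size_scale // size_prod_XsubC.
have rn : (size r <= n)%N by rewrite -ltnS -sh rm_fiber_size.
have rP w : (w \in r) = root h w by rewrite hE rootZ // root_prod_XsubC.
have hn : (h`_n == 0) = (size r < n)%N.
  have [e|ne] := eqVneq (size r) n.
    by rewrite -e ltnn -[size r]/((size r).+1.-1) -sh lead_coef_eq0 (negPf h0).
  by rewrite ltn_neqAle ne rn nth_default ?eqxx // sh ltn_neqAle ne.
pose s' : seq (P1 R) := map Some (undup r) ++ (if (size r < n)%N then [:: None] else [::]).
have pss' : perm_eq s s'.
  apply: uniq_perm => //.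
    rewrite cat_uniq map_inj_uniq ?undup_uniq; last by move=> ? ? [].
    case: ifP => //= _; rewrite orbF andbT; apply/mapP => -[? _]; discriminate.
  move=> p; rewrite sP rm_fun_fiber -/h -/n mem_cat; case: p => [w|].
    rewrite mem_map ?mem_undup -?rP; last by move=> ? ? [].
    by case: ifP => _; rewrite ?inE orbF.
  rewrite hn; case: ifP => _; first by rewrite orbT.
  by rewrite orbF; apply/esym/negbTE/mapP => -[].
have ldS w : w \in undup r -> local_degree f (Some w) = count_mem w r.
  rewrite mem_undup rP => rw; rewrite /local_degree.
  have /eqP -> : f (Some w) == q by rewrite rm_fun_fiber.
  by rewrite -/h hE mupZ // mup_prod_XsubC.
have ldN : (size r < n)%N -> local_degree f None = (n - size r)%N.
  move=> lt; rewrite /local_degree.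
  have /eqP -> : f None == q by rewrite rm_fun_fiber -/h -/n hn.
  by rewrite -/h sh.
split.
  rewrite (perm_big _ pss') big_cat big_map /=.
  rewrite (eq_big_seq _ ldS).
  have -> : (\sum_(w <- undup r) count_mem w r = size r)%N.
    rewrite -sum1_size -[RHS]big_undup_iterop_count; apply: eq_bigr => w _.
    by rewrite Monoid.iteropE iter_addn mul1n addn0.
  case: ifP => lt; rewrite ?big_seq1 ?ldN ?subnKC // big_nil addn0.
  by apply/eqP; rewrite eqn_leq rn leqNgt lt.
have [k k0 kE] : exists2 k, k != 0 & forall x, wedge (rm_lift f x) (hlift q) = k * hform n h x.
  rewrite /wedge /rm_lift /h /rm_fiber -/n.
  case: q {sP h h0 hE c0 sh rn rP hn s' pss' ldS ldN} => [c|] /=.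
    by exists 1; rewrite ?oner_eq0 // => x; rewrite hformB; ring.
  by exists (-1); rewrite ?oppr_eq0 ?oner_eq0 // => x; ring.
exists (k * lead_coef h * (-1) ^+ (n - size r)).
  by rewrite !mulf_neq0 // expf_neq0 // oppr_eq0 oner_eq0.
move=> x; rewrite kE [in LHS]hE hform_prod // (perm_big _ pss') big_cat big_map /=.
have -> : \prod_(w <- undup r) wedge x (w, 1) ^+ local_degree f (Some w) =
    \prod_(w <- r) (x.1 - w * x.2).
  rewrite -[RHS]big_undup_iterop_count; apply: eq_big_seq => w /ldS ->.
  by rewrite /wedge /= mulr1 [x.2 * w]mulrC.
have -> : \prod_(p <- if (size r < n)%N then [:: None] else [::])
    wedge x (hlift p) ^+ local_degree f p = (- x.2) ^+ (n - size r).
  case: ifP => lt; first by rewrite big_seq1 ldN // /wedge /= mulr0 mulr1 sub0r.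
  by rewrite big_nil; have /eqP -> : (n - size r == 0)%N by rewrite subn_eq0 leqNgt lt.
rewrite -[- x.2]mulN1r exprMn.
have : (-1) ^+ (n - size r) * (-1) ^+ (n - size r) = 1 :> C by rewrite -expr2 sqrr_sign.
move: (lead_coef h) (\prod_(w <- r) _) (x.2 ^+ _) ((-1) ^+ _) => c P X e e1.
by transitivity (k * (c * P * X) * (e * e)); [rewrite e1 mulr1|ring].
Qed.

End RationalMaps.

(** * Flows on trees and degrees of covers *)

(** Summing the divergence over the branch, the contributions of the edges inside
it cancel, and only the edge by which it is attached remains. *)
Lemma flow_branch (X : finType) (T : ctree X) (psi : vertex T -> vertex T -> int)
    (a b : vertex T) :
  (forall x y, psi x y = - psi y x) -> (forall x y, ~~ adj x y -> psi x y = 0) ->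
  adj a b -> psi a b = - \sum_(c | branch a b c) \sum_c' psi c c'.
Proof.
move=> anti nadj ab.
have -> : \sum_(c | branch a b c) \sum_c' psi c c' =
    \sum_(c | branch a b c) \sum_(c' | branch a b c') psi c c' +
    \sum_(c | branch a b c) \sum_(c' | ~~ branch a b c') psi c c'.
  by rewrite -big_split /=; apply: eq_bigr => c _; rewrite (bigID (branch a b)).
have -> : \sum_(c | branch a b c) \sum_(c' | branch a b c') psi c c' = 0.
  set S := LHS; suff : S = - S by lia.
  rewrite {1}/S exchange_big /= -sumrN; apply: eq_bigr => c _.
  by rewrite -sumrN; apply: eq_bigr => c' _; exact: anti.
have out c c' : branch a b c -> ~~ branch a b c' -> psi c c' != 0 -> c = b /\ c' = a.
  move=> bc nbc' ne; have cc' : adj c c' by apply: contraNT ne => /nadj ->.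
  have /orP[h|/andP[/eqP-> /eqP->]//] := branch_step bc cc'.
  by rewrite h in nbc'.
rewrite add0r (bigD1 b) ?branchxx //= (bigD1 a) ?bridge //=.
rewrite [X in _ + X + _]big1 => [|c' /andP[nbc' ne]]; last first.
  apply/eqP/negPn/negP => /(out _ _ (branchxx a b) nbc')[_ e].
  by rewrite e eqxx in ne.
rewrite [X in _ + X]big1 => [|c /andP[bc ne]]; last first.
  rewrite big1 // => c' nbc'; apply/eqP/negPn/negP => /(out _ _ bc nbc')[e _].
  by rewrite e eqxx in ne.
by rewrite !addr0; exact: anti.
Qed.

Section Covers.
Variables (R : realType) (d : nat) (Y Z : finType) (P : portrait d Y Z).
Variables (F : tree_cover R Y Z) (FP : has_portrait F P).
Local Notation C := R[i].
Local Notation TY := (tc_src F).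
Local Notation TZ := (tc_tgt F).
Local Notation Fv := (tm_vert (tc_map F)).
Local Notation Fi := (tm_int (tc_map F)).

(** All points of the fibre over a marked point are marked, because [tc_fun F v]
maps the complement of the marked points into the complement. *)
Lemma cover_fiber (v : 'I_(nint TY)) (c : vertex TZ) (f := tc_fun F v) :
    adj (inl (Fi v)) c ->
  (\sum_(u | adj (inl v) u && (Fv u == c)) local_degree f (pt v u) = rm_degree f)%N /\
  exists2 k : C, k != 0 & forall x,
    wedge (rm_lift f x) (hlift (pt (Fi v) c)) =
    k * \prod_(u | adj (inl v) u && (Fv u == c))
          wedge x (hlift (pt v u)) ^+ local_degree f (pt v u).
Proof.
move=> wc; pose A := [pred u | adj (inl v : vertex TY) u && (Fv u == c)].
have [] := @fiber_factor R f (pt (Fi v) c) [seq pt v u | u <- enum A].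
- rewrite map_inj_in_uniq ?enum_uniq // => u u'.
  rewrite !mem_enum !inE => /andP[vu _] /andP[vu' _]; exact: pt_inj.
- move=> p; apply/mapP/eqP => [[u]|fp].
    by rewrite mem_enum inE => /andP[vu /eqP<-] ->; exact: tc_pt.
  have [u vu pu] : marked_points v p.
    apply: contrapT => np; have [sub _] := @tc_covering _ _ _ F v.
    by have [] := sub (f p); [exists p|exists c].
  exists u => //; rewrite mem_enum inE vu /=; apply/eqP.
  apply: (pt_inj (v := Fi v)) => //; first exact: tm_adj vu.
  by rewrite -fp pu; apply/esym/tc_pt.
rewrite big_map big_enum /= => e [k k0 kE]; split=> //.
by exists k => // x; rewrite kE big_map big_enum.
Qed.

(** Read off at an internal end of the edge; when both ends are internal they
agree, by [tc_degree]. *)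
Definition edge_degree (a b : vertex TY) : nat :=
  match a, b with
  | inl v, _ => local_degree (tc_fun F v) (pt v b)
  | inr y, inl v => local_degree (tc_fun F v) (pt v (inr y))
  | inr _, inr _ => 0
  end.

Lemma edge_degreeC a b : adj a b -> edge_degree a b = edge_degree b a.
Proof. by case: a b => [v|y] [v'|y'] //=; exact: tc_degree. Qed.

Lemma toward_Fv (v : 'I_(nint TY)) u z : adj (inl v) u ->
  branch (inl (Fi v) : vertex TZ) (Fv u) (inr z) = (toward (Fi v) z == Fv u).
Proof. by move=> vu; apply: towardE; exact: tm_adj vu. Qed.

(** The unit flow from [z'] to [z] along [TZ], pulled back to [TY]. *)
Definition pulled_flow (z z' : Z) (a b : vertex TY) : int :=
  if adj a b then
    (edge_degree a b)%:Z * ((branch (Fv a) (Fv b) (inr z) : nat)%:Z -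
                            (branch (Fv a) (Fv b) (inr z') : nat)%:Z)
  else 0.

Lemma pulled_flow_anti z z' a b : pulled_flow z z' a b = - pulled_flow z z' b a.
Proof.
rewrite /pulled_flow adj_sym; case: ifP => [ba|]; last by rewrite oppr0.
have Fba := @tm_adj _ _ _ _ (tc_map F) _ _ ba.
rewrite edge_degreeC 1?adj_sym // !(branchC _ Fba).
by case: (branch _ _ (inr z)); case: (branch _ _ (inr z')); rewrite /=; lia.
Qed.

(** The degrees of the edges above each edge at [Fi v] add up to the degree of
[tc_fun F v], so conservation at [Fi v] gives conservation at [v]. *)
Lemma pulled_flow_int z z' (v : 'I_(nint TY)) :
  \sum_b pulled_flow z z' (inl v) b = 0.
Proof.
have half y : \sum_(b | adj (inl v : vertex TY) b)
    (edge_degree (inl v) b)%:Z * (branch (Fv (inl v)) (Fv b) (inr y) : nat)%:Z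
    = (rm_degree (tc_fun F v))%:Z :> int.
  have [<- _] := cover_fiber (toward_adj (Fi v) y).
  rewrite (big_morph Posz PoszD erefl) big_mkcondr /=; apply: eq_bigr => b vb.
  by rewrite toward_Fv // eq_sym; case: eqP => _ /=; rewrite ?mulr1 ?mulr0.
rewrite /pulled_flow -big_mkcond /=.
under eq_bigr do rewrite mulrBr.
by rewrite sumrB !half subrr.
Qed.

Lemma pulled_flow_leaf (v0 : 'I_(nint TY)) z z' (y : Y) :
  \sum_b pulled_flow z z' (inr y) b =
  (pdeg P y)%:Z * ((pmap P y == z' : nat)%:Z - (pmap P y == z : nat)%:Z).
Proof.
have /card_gt0P[b yb] : (0 < #|adj (inr y : vertex TY)|)%N by rewrite adj_leaf.
rewrite unfold_in in yb.
have [v bE] := leaf_adj_int v0 yb; rewrite {}bE in yb.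
rewrite (bigD1 (inl v)) //= big1 ?addr0 => [|c ne]; last first.
  rewrite /pulled_flow; case: ifP => // yb'.
  by rewrite (leaf_adj_uniq yb' yb) eqxx in ne.
have [Fl Fd] := FP.
rewrite /pulled_flow ifT // [edge_degree _ _]Fd; last by rewrite adj_sym.
rewrite [Fv (inr y)]/= Fl [Fv (inl v)]/=.
have Fyb : adj (inr (pmap P y) : vertex TZ) (inl (Fi v)).
  by have := @tm_adj _ _ _ _ (tc_map F) _ _ yb; rewrite /= Fl.
rewrite !leaf_cobranch //.
have eqE x x' : ((inr x : vertex TZ) == inr x') = (x == x').
  by apply/eqP/eqP => [[]|->].
rewrite !eqE (eq_sym z) (eq_sym z'); case: eqP => _; case: eqP => _ /=; lia.
Qed.

Definition branch_count (v : 'I_(nint TY)) (u : vertex TY) (z : Z) : nat :=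
  (\sum_(y | (pmap P y == z) && (toward v y == u)) pdeg P y)%N.

(** Both sides compare the pulled-back flow through the edge from [v] to [u] with
what the leaves of its branch absorb. The identity is the difference of two such
counts, rearranged so that no subtraction occurs. *)
Lemma flow_identity (v : 'I_(nint TY)) u z z' : adj (inl v) u ->
  let l := local_degree (tc_fun F v) (pt v u) in
  (branch_count v u z + l * (Fv u == toward (Fi v) z') =
   branch_count v u z' + l * (Fv u == toward (Fi v) z))%N.
Proof.
move=> vu l.
have := flow_branch (pulled_flow_anti z z') _ vu.
have nadj x y : ~~ adj x y -> pulled_flow z z' x y = 0.
  by move=> /negPf n; rewrite /pulled_flow n.
move=> /(_ nadj).
rewrite {1}/pulled_flow vu !toward_Fv // big_sumType /= big1 ?add0r; last first.
  by move=> w _; exact: pulled_flow_int.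
under eq_bigr do rewrite (pulled_flow_leaf v).
have cnt t : (\sum_(y | branch (inl v) u (inr y)) (pdeg P y)%:Z * (pmap P y == t : nat)%:Z
    = (branch_count v u t)%:Z)%R.
  rewrite /branch_count (big_morph Posz PoszD erefl) big_mkcondl /=.
  apply: eq_big => y; first by rewrite towardE.
  by move=> _; case: eqP => _; rewrite /= ?mulr1 ?mulr0.
under eq_bigr do rewrite mulrBr.
rewrite sumrB !cnt -/l [in X in _ -> X](eq_sym (Fv u)) [in X in _ -> X](eq_sym (Fv u)).
by case: eqP => _; case: eqP => _ /=; lia.
Qed.

End Covers.

(** * A cover recovered from its fibres *)

Section CoverFormula.
Variables (R : realType) (d : nat) (Y Z : finType) (P : portrait d Y Z).
Variables (F : tree_cover R Y Z) (FP : has_portrait F P).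
Local Notation C := R[i].
Local Notation TY := (tc_src F).
Local Notation TZ := (tc_tgt F).
Local Notation Fv := (tm_vert (tc_map F)).
Local Notation Fi := (tm_int (tc_map F)).

(** The form Phi_z of the introduction. Arbitrary lifts [b y] are allowed, for the
sake of passing to limits. *)
Definition fiber_form (b : Y -> C * C) (z : Z) (x : C * C) : C :=
  \prod_(y | pmap P y == z) wedge x (b y) ^+ pdeg P y.

Lemma fiber_form_neq0 (b : Y -> C * C) z x :
  (forall y, wedge x (b y) != 0) -> fiber_form b z x != 0.
Proof. by move=> h; apply/prodf_neq0 => y _; rewrite expf_neq0. Qed.

Lemma fiber_form_branches (v : 'I_(nint TY)) (b : Y -> C * C) :
  (forall y, nonzero (b y) /\ hp (b y) = marking v y) ->
  forall z, exists2 k : C, k != 0 & forall x, fiber_form b z x =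
    k * \prod_(u | adj (inl v) u) wedge x (hlift (pt v u)) ^+ branch_count P v u z.
Proof.
move=> bP z.
have /choice[k kP] y : exists k : C, k != 0 /\ b y = scale k (hlift (marking v y)).
  by have [b0 <-] := bP y; have [k k0 e] := hp_lift_scale b0; exists k.
exists (\prod_(y | pmap P y == z) k y ^+ pdeg P y).
  by apply/prodf_neq0 => y _; rewrite expf_neq0 //; case: (kP y).
move=> x; rewrite /fiber_form.
have -> : \prod_(y | pmap P y == z) wedge x (b y) ^+ pdeg P y =
  \prod_(y | pmap P y == z) (k y ^+ pdeg P y) *
  \prod_(y | pmap P y == z) wedge x (hlift (marking v y)) ^+ pdeg P y.
  rewrite -big_split /=; apply: eq_bigr => y _.
  by have [_ {1}->] := kP y; rewrite wedge_scaler exprMn.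
congr (_ * _); rewrite (partition_big (toward v) (adj (inl v))) /=; last first.
  by move=> y _; exact: toward_adj.
apply: eq_bigr => u vu; rewrite /branch_count -prodrXr.
by apply: eq_bigr => y /andP[_ /eqP e]; rewrite /marking e.
Qed.

(** By [flow_identity], the product of [fiber_form b z] with the form of the fibre
of [f_v] over the mark of [z0] is symmetric in [z] and [z0], up to a constant. So
the quotient of [fiber_form b z] by the form of the fibre over the mark of [z] is,
up to a constant, independent of [z]: it is the common divisor [E]. *)
Lemma fiber_form_lift (v : 'I_(nint TY)) (b : Y -> C * C) (z0 : Z) :
  (forall y, nonzero (b y) /\ hp (b y) = marking v y) ->
  exists (k : Z -> C) (E : C * C -> C), (forall z, k z != 0) /\
    forall x, (forall y, wedge x (b y) != 0) -> E x != 0 /\ forall z,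
      fiber_form b z x =
      k z * E x * wedge (rm_lift (tc_fun F v) x) (hlift (marking (Fi v) z)).
Proof.
move=> bP; pose f := tc_fun F v.
have /choice[K KP] z : exists k : C, k != 0 /\ forall x, fiber_form b z x =
    k * \prod_(u | adj (inl v) u) wedge x (hlift (pt v u)) ^+ branch_count P v u z.
  by have [k k0 kE] := fiber_form_branches bP z; exists k.
pose l u := local_degree f (pt v u).
have /choice[J JP] z : exists k : C, k != 0 /\ forall x,
    wedge (rm_lift f x) (hlift (marking (Fi v) z)) =
    k * \prod_(u | adj (inl v) u)
          wedge x (hlift (pt v u)) ^+ (l u * (Fv u == toward (Fi v) z)).
  have [_ [k k0 kE]] := cover_fiber (toward_adj (Fi v) z).
  exists k; split=> // x; rewrite kE big_mkcondr /=; congr (_ * _).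
  by apply: eq_bigr => u vu; case: eqP => _; rewrite ?muln1 ?muln0.
pose E x := fiber_form b z0 x / wedge (rm_lift f x) (hlift (marking (Fi v) z0)).
exists (fun z => K z * J z0 / (K z0 * J z)), E; split.
  have Kz t : K t != 0 by case: (KP t).
  have Jz t : J t != 0 by case: (JP t).
  move=> z;
  by rewrite !mulf_neq0 // invr_eq0 mulf_neq0.
move=> x off; have wu u : adj (inl v) u -> wedge x (hlift (pt v u)) != 0.
  move=> vu; have [y yu] := toward_surj vu; have [b0 hb] := bP y.
  have [k k0 e] := hp_lift_scale b0; have := off y.
  by rewrite e wedge_scaler hb /marking yu mulf_eq0 negb_or => /andP[].
have W0 z : wedge (rm_lift f x) (hlift (marking (Fi v) z)) != 0.
  have [k0 ->] := JP z; rewrite mulf_neq0 //; apply/prodf_neq0 => u vu.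
  by rewrite expf_neq0 // wu.
split; first by rewrite mulf_neq0 ?fiber_form_neq0 // invr_eq0.
move=> z; have [[Kz KzE] [K0 K0E]] := (KP z, KP z0).
have [[Jz JzE] [J0 J0E]] := (JP z, JP z0).
have flow : \prod_(u | adj (inl v) u) wedge x (hlift (pt v u)) ^+ branch_count P v u z *
  \prod_(u | adj (inl v) u) wedge x (hlift (pt v u)) ^+ (l u * (Fv u == toward (Fi v) z0)) =
  \prod_(u | adj (inl v) u) wedge x (hlift (pt v u)) ^+ branch_count P v u z0 *
  \prod_(u | adj (inl v) u) wedge x (hlift (pt v u)) ^+ (l u * (Fv u == toward (Fi v) z)).
  rewrite -!big_split /=; apply: eq_bigr => u vu.
  by rewrite -!exprD (flow_identity FP z z0 vu).
have := W0 z0; rewrite /E KzE K0E JzE J0E; move: flow.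
set A := \prod_(u | _) _; set B := \prod_(u | _) _ => flow.
move: flow; set A' := \prod_(u | _) _; set B' := \prod_(u | _) _ => flow.
rewrite mulf_eq0 negb_or => /andP[_ B0].
transitivity (K z * (A * B) / B); first by field.
by rewrite flow; field; rewrite J0 K0 Jz B0.
Qed.

Lemma fiber_form_mact (m : mobius R) (b : Y -> C * C) z x :
  fiber_form (fun y => mact m (b y)) z (mact m x) = mdet m ^+ d * fiber_form b z x.
Proof.
rewrite /fiber_form -[in mdet m ^+ d](pdeg_fiber P z) -prodrXr -big_split /=.
by apply: eq_bigr => y _; rewrite wedge_mact exprMn.
Qed.

Definition pencil_map (b : Y -> C * C) (z0 z1 : Z) (x : C * C) : C * C :=
  (fiber_form b z0 x, fiber_form b z1 x).

(** The vector [q] with [wedge (pencil_map b z0 z1 x) q = fiber_form b z x] for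
all [x], up to a constant, solved by Cramer's rule from its values at [x1] and
[x2]: it is the target point whose fibre is cut out by [fiber_form b z]. *)
Definition pencil_mark (b : Y -> C * C) (z0 z1 z : Z) (x1 x2 : C * C) : C * C :=
  (fiber_form b z x1 * (pencil_map b z0 z1 x2).1 -
     fiber_form b z x2 * (pencil_map b z0 z1 x1).1,
   fiber_form b z x1 * (pencil_map b z0 z1 x2).2 -
     fiber_form b z x2 * (pencil_map b z0 z1 x1).2).

(** The common divisor of [fiber_form_lift] disappears in homogeneous coordinates.
What remains is a linear change of coordinates in the target: its matrix sends
[H] to the pairings of [H] with the marks of [z0] and [z1], which is invertible
because these marks are distinct. *)
Lemma cover_formula (v : 'I_(nint TY)) (phi : mobius R) (b : Y -> C * C) (z0 z1 : Z) :
  (forall y, nonzero (b y) /\ hp (b y) = phi (marking v y)) ->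
  toward (Fi v) z0 != toward (Fi v) z1 ->
  exists L : mobius R,
    (forall x, nonzero x -> (forall y, wedge x (b y) != 0) ->
       L (tc_fun F v (mob_inv phi (hp x))) = hp (pencil_map b z0 z1 x)) /\
    (forall z x1 x2,
       (forall y, wedge x1 (b y) != 0) -> (forall y, wedge x2 (b y) != 0) ->
       wedge (pencil_map b z0 z1 x1) (pencil_map b z0 z1 x2) != 0 ->
       nonzero (pencil_mark b z0 z1 z x1 x2) /\
       L (marking (Fi v) z) = hp (pencil_mark b z0 z1 z x1 x2)).
Proof.
move=> bP t01; pose f := tc_fun F v; pose m := mob_inv phi.
pose b' y := mact m (b y).
have b'P y : nonzero (b' y) /\ hp (b' y) = marking v y.
  have [b0 hb] := bP y; split; first exact: mact_nonzero.
  by rewrite -mob_hp // hb mob_invK.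
have [k [E [k0 kE]]] := fiber_form_lift z0 b'P.
pose q z := hlift (marking (Fi v) z).
have D0 : mdet m ^+ d != 0 by rewrite expf_neq0 // mdet_neq0.
(* In the source, [phi] multiplies all forms of degree [d] by the same constant. *)
have form x : (forall y, wedge x (b y) != 0) -> exists2 e : C, e != 0 &
    forall z, fiber_form b z x = e * (k z * wedge (rm_lift f (mact m x)) (q z)).
  move=> off; have [|E0 EE] := kE (mact m x).
    by move=> y; rewrite /b' wedge_mact mulf_neq0 // mdet_neq0.
  exists (E (mact m x) / mdet m ^+ d); first by rewrite mulf_neq0 // invr_eq0.
  move=> z; have := EE z; rewrite fiber_form_mact => e; apply: (mulfI D0).
  by rewrite e; field.
have detL : (k z0 * (q z0).2) * (- (k z1 * (q z1).1)) -
    (- (k z0 * (q z0).1)) * (k z1 * (q z1).2) != 0.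
  have : k z0 * k z1 * wedge (q z0) (q z1) != 0.
    rewrite !mulf_neq0 // wedge_lift_eq0; apply: contra t01 => /eqP e.
    by apply/eqP; apply: (pt_inj (v := Fi v)) e; exact: toward_adj.
  by apply: contra => /eqP e; apply/eqP; rewrite -e /wedge; ring.
pose L := Mobius detL; exists L.
have Lmap x : (forall y, wedge x (b y) != 0) -> exists2 e : C, e != 0 &
    pencil_map b z0 z1 x = scale e (mact L (rm_lift f (mact m x))) /\
    forall z, fiber_form b z x = e * (k z * wedge (rm_lift f (mact m x)) (q z)).
  move=> /form[e e0 eE]; exists e => //; split=> //.
  by rewrite /pencil_map !eE /scale /mact /wedge /=; congr pair; ring.
split=> [x x0 /Lmap[e e0 [-> _]]|z x1 x2 off1 off2].
  have mx0 := mact_nonzero m x0.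
  by rewrite mob_hp // (rm_hp f) // mob_hp ?rm_lift_nonzero // hp_scale.
have [e1 e10 [G1 F1]] := Lmap _ off1; have [e2 e20 [G2 F2]] := Lmap _ off2.
set H1 := rm_lift f (mact m x1) in G1 F1; set H2 := rm_lift f (mact m x2) in G2 F2.
rewrite G1 G2 wedge_scalel wedge_scaler wedge_mact.
rewrite !mulf_eq0 !negb_or => /and4P[_ _ _ W0].
have -> : pencil_mark b z0 z1 z x1 x2 =
    scale (k z * e1 * e2 * wedge H1 H2) (mact L (q z)).
  by rewrite /pencil_mark G1 G2 F1 F2 /scale /mact /wedge /=; congr pair; ring.
have c0 : k z * e1 * e2 * wedge H1 H2 != 0 by rewrite !mulf_neq0.
split; first by apply: nonzero_scale => //; apply: mact_nonzero; exact: lift_nonzero.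
by rewrite hp_scale // -mob_hp ?lift_nonzero // hp_lift.
Qed.

End CoverFormula.

(** * The chordal metric *)

Definition cabs (R : realType) (z : R[i]) : R := Normc.normc z.
Arguments cabs {R} z : simpl never.

Section ChordalMetric.
Variable R : realType.
Local Notation C := R[i].
Implicit Types (x y : C * C) (p q : P1 R) (z w : C) (e : R).

Lemma cabsM z w : cabs (z * w) = cabs z * cabs w. Proof. exact: Normc.normcM. Qed.
Lemma cabsD z w : cabs (z + w) <= cabs z + cabs w. Proof. exact: le_normcD. Qed.
Lemma cabsN z : cabs (- z) = cabs z. Proof. exact: normcN. Qed.
Lemma cabs1 : cabs (1 : C) = 1. Proof. exact: Normc.normc1. Qed.
Lemma cabs0 : cabs (0 : C) = 0. Proof. exact: Normc.normc0. Qed.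
Lemma cabsV z : cabs z^-1 = (cabs z)^-1. Proof. exact: Normc.normcV. Qed.
Lemma cabs_sqr z : cabs z ^+ 2 = complex.Re z ^+ 2 + complex.Im z ^+ 2.
Proof. by case: z => a b; rewrite /cabs /= sqr_sqrtr // addr_ge0 ?sqr_ge0. Qed.
Lemma cabs_ge0 z : 0 <= cabs z. Proof. by case: z => a b; exact: sqrtr_ge0. Qed.
Lemma cabs_eq0 z : (cabs z == 0) = (z == 0).
Proof. by apply/eqP/eqP => [/Normc.eq0_normc|->]; rewrite ?cabs0. Qed.
Lemma cabs_gt0 z : (0 < cabs z) = (z != 0).
Proof. by rewrite lt_def cabs_ge0 cabs_eq0 andbT. Qed.

Definition nsq x : R := cabs x.1 ^+ 2 + cabs x.2 ^+ 2.

Lemma nsq_ge0 x : 0 <= nsq x. Proof. by rewrite addr_ge0 ?sqr_ge0. Qed.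

Lemma nsq_gt0 x : (0 < nsq x) = nonzero x.
Proof.
rewrite lt_def nsq_ge0 andbT /nsq paddr_eq0 ?sqr_ge0 // !sqrf_eq0 !cabs_eq0.
by rewrite negb_and.
Qed.

Lemma nsq_scale z x : nsq (scale z x) = cabs z ^+ 2 * nsq x.
Proof. by rewrite /nsq /= !cabsM !exprMn mulrDr. Qed.

Lemma nsq_hlift p : 1 <= nsq (hlift p).
Proof.
rewrite /nsq; case: p => [w|] /=; rewrite cabs1 expr1n ?cabs0 ?expr0n ?addr0 //.
by rewrite lerDr sqr_ge0.
Qed.

(** The Hopf map from C^2 to R^3. *)
Definition hopf x : R * R * R :=
  let: (Complex a b, Complex c d) := x in
  ((a * c + b * d) * 2, (b * c - a * d) * 2, a ^+ 2 + b ^+ 2 - c ^+ 2 - d ^+ 2)%R.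

Lemma stereo_hp x : nonzero x ->
  stereo (hp x) = ((hopf x).1.1 / nsq x, (hopf x).1.2 / nsq x, (hopf x).2 / nsq x).
Proof.
move=> x0; have n0 : nsq x != 0 by rewrite gt_eqF // nsq_gt0.
have [[k1 k2] k0 xE] := hp_lift_scale x0; move: xE n0.
have triple (a a' b b' c c' : R) : a = a' -> b = b' -> c = c' ->
  (a, b, c) = (a', b', c') by move=> -> -> ->.
have kn : k1 ^+ 2 + k2 ^+ 2 != 0 by rewrite -(cabs_sqr (Complex k1 k2)) sqrf_eq0 cabs_eq0.
case: (hp x) => [[a b]|] -> ; rewrite nsq_scale /nsq !cabs_sqr /= => n0.
  move: n0; rewrite !(mulr0, mulr1, mul0r, addr0, subr0, expr0n, expr1n) /=.
  rewrite mulf_eq0 negb_or => /andP[_ n0].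
  have n1 : 1 + a ^+ 2 + b ^+ 2 != 0 by move: n0; congr (_ != _); ring.
  by apply: triple; field; rewrite ?n0 ?n1 ?kn.
move: n0; rewrite !(mulr0, mulr1, mul0r, addr0, subr0, expr0n, expr1n) /= => n0.
by apply: triple; field; rewrite ?kn.
Qed.

Lemma hopf_sqr x : (hopf x).1.1 ^+ 2 + (hopf x).1.2 ^+ 2 + (hopf x).2 ^+ 2 = nsq x ^+ 2.
Proof. by case: x => [[a b] [c d]]; rewrite /nsq !cabs_sqr /=; ring. Qed.

Lemma hopf_wedge x y :
  nsq x * nsq y - ((hopf x).1.1 * (hopf y).1.1 + (hopf x).1.2 * (hopf y).1.2 +
                   (hopf x).2 * (hopf y).2) = 2 * cabs (wedge x y) ^+ 2.
Proof.
by case: x y => [[a b] [c d]] [[a' b'] [c' d']]; rewrite /nsq !cabs_sqr /wedge /=; ring.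
Qed.

(** The square of the Euclidean distance of two points of the unit sphere is twice
one minus their inner product, which [hopf_wedge] computes. *)
Lemma chordal x y (s := stereo (hp x)) (t := stereo (hp y)) :
  nonzero x -> nonzero y ->
  ((s.1.1 - t.1.1) ^+ 2 + (s.1.2 - t.1.2) ^+ 2 + (s.2 - t.2) ^+ 2) * (nsq x * nsq y)
  = 4 * cabs (wedge x y) ^+ 2.
Proof.
move=> x0 y0; rewrite /s /t !stereo_hp //=.
have := hopf_wedge x y; have := hopf_sqr x; have := hopf_sqr y.
have nx : nsq x != 0 by rewrite gt_eqF // nsq_gt0.
have ny : nsq y != 0 by rewrite gt_eqF // nsq_gt0.
move: (hopf x) (hopf y) (nsq x) (nsq y) (cabs _ ^+ 2) nx ny.
move=> [[A B] D] [[A' B'] D'] n n' W /= n0 n0' e2 e1 e3.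
have -> : 4 * W = 2 * (n * n' - (A * A' + B * B' + D * D')) by rewrite e3; ring.
transitivity (((A ^+ 2 + B ^+ 2 + D ^+ 2) * n' ^+ 2 + (A' ^+ 2 + B' ^+ 2 + D' ^+ 2) * n ^+ 2
  - 2 * n * n' * (A * A' + B * B' + D * D')) / (n * n')); first by field; rewrite ?n0 ?n0'.
by rewrite e1 e2; field; rewrite ?n0 ?n0'.
Qed.

Lemma P1_ballE p e q : ball p e q <->
  [/\ `|(stereo p).1.1 - (stereo q).1.1| < e, `|(stereo p).1.2 - (stereo q).1.2| < e &
      `|(stereo p).2 - (stereo q).2| < e].
Proof.
rewrite -initial_ballE.
split=> [[[] /= h1 h2 h3]|[h1 h2 h3]]; first by split.
by split; first split.
Qed.

Lemma ball_hp x y e : nonzero x -> nonzero y -> 0 < e ->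
  4 * cabs (wedge x y) ^+ 2 < e ^+ 2 * (nsq x * nsq y) -> ball (hp x) e (hp y).
Proof.
move=> x0 y0 e0; rewrite -chordal // ltr_pM2r ?mulr_gt0 ?nsq_gt0 // => lt.
have sq (u : R) : u ^+ 2 < e ^+ 2 -> `|u| < e.
  by rewrite -real_normK ?num_real // ltr_pXn2r // nnegrE ?ltW.
move: lt; set u := _ - _; set v := _ - _; set w := _ - _ => lt.
have := sqr_ge0 u; have := sqr_ge0 v; have := sqr_ge0 w => w0 v0 u0.
by apply/P1_ballE; split; apply: sq; rewrite -/u -/v -/w; lra.
Qed.

Lemma ball_wedge x y e : nonzero x -> nonzero y ->
  ball (hp x) e (hp y) -> 4 * cabs (wedge x y) ^+ 2 < 3 * e ^+ 2 * (nsq x * nsq y).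
Proof.
move=> x0 y0 /P1_ballE[h1 h2 h3].
rewrite -chordal // ltr_pM2r ?mulr_gt0 ?nsq_gt0 //.
have e0 : 0 < e by apply: le_lt_trans h1.
have sq (u : R) : `|u| < e -> u ^+ 2 < e ^+ 2.
  by move=> h; rewrite -real_normK ?num_real // ltr_pXn2r // nnegrE ltW.
by have := sq _ h1; have := sq _ h2; have := sq _ h3; lra.
Qed.

Lemma P1_separated p q : p != q -> exists2 e, 0 < e & ~ ball p e q.
Proof.
move=> pq; pose x := hlift p; pose y := hlift q.
have W0 : 0 < cabs (wedge x y) ^+ 2.
  by rewrite exprn_gt0 // cabs_gt0 wedge_lift_eq0.
have n0 : 0 < nsq x * nsq y by rewrite mulr_gt0 ?nsq_gt0 ?lift_nonzero.
pose t := cabs (wedge x y) ^+ 2 / (nsq x * nsq y).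
have t0 : 0 < t by rewrite divr_gt0.
exists (Num.sqrt t); first by rewrite sqrtr_gt0.
rewrite -(hp_lift p) -(hp_lift q) => /ball_wedge.
rewrite sqr_sqrtr ?ltW // => /(_ (lift_nonzero _) (lift_nonzero _)).
rewrite -/x -/y /t -mulrA divfK ?gt_eqF //; lra.
Qed.

(** By the Cauchy-Schwarz inequality, with the squared entries of the matrix. *)
Lemma nsq_mact_le (m : mobius R) : exists2 K : R, 0 < K &
  forall x, nsq (mact m x) <= K * nsq x.
Proof.
exists (cabs (mob_a m) ^+ 2 + cabs (mob_b m) ^+ 2 + cabs (mob_c m) ^+ 2 +
  cabs (mob_d m) ^+ 2 + 1).
  by rewrite ltr_wpDl // !addr_ge0 ?sqr_ge0.
move=> x.
have half (a b : C) : cabs (a * x.1 + b * x.2) ^+ 2 <= (cabs a ^+ 2 + cabs b ^+ 2) * nsq x.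
  apply: (@le_trans _ _ ((cabs a * cabs x.1 + cabs b * cabs x.2) ^+ 2)).
    by rewrite ler_pXn2r ?nnegrE ?cabs_ge0 // ?addr_ge0 ?mulr_ge0 ?cabs_ge0 //
      -!cabsM cabsD.
  rewrite -subr_ge0 /nsq; apply: le_trans (sqr_ge0 (cabs a * cabs x.2 - cabs b * cabs x.1)) _.
  by rewrite le_eqVlt; apply/orP; left; apply/eqP; ring.
have := half (mob_a m) (mob_b m); have := half (mob_c m) (mob_d m).
have := nsq_ge0 x; rewrite {4}/nsq /mact /=; lra.
Qed.

Lemma mact_invK (m : mobius R) x : mact (mob_inv m) (mact m x) = scale (mdet m) x.
Proof. by rewrite /mact /scale /mdet /=; congr pair; ring. Qed.

(** In the chordal distance, the numerator [wedge] is multiplied by the determinant,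
and the norms in the denominator change by bounded factors, as [m] and its inverse
are both bounded. *)
Lemma mob_unif (m : mobius R) e : 0 < e -> exists2 r : R, 0 < r &
  forall p q, ball p r q -> ball (m p) e (m q).
Proof.
move=> e0; have [K K0 KP] := nsq_mact_le (mob_inv m).
pose D := cabs (mdet m) ^+ 2.
have D0 : 0 < D by rewrite exprn_gt0 // cabs_gt0 mdet_neq0.
have low x : D * nsq x <= K * nsq (mact m x).
  by rewrite /D -nsq_scale -mact_invK.
pose t := e ^+ 2 * D / (3 * K ^+ 2).
have t0 : 0 < t by rewrite divr_gt0 // mulr_gt0 // exprn_gt0.
exists (Num.sqrt t); first by rewrite sqrtr_gt0.
move=> p q; rewrite -(hp_lift p) -(hp_lift q).
have [x0 y0] := (lift_nonzero p, lift_nonzero q).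
move: (hlift p) (hlift q) x0 y0 => x y x0 y0 /(ball_wedge x0 y0).
rewrite sqr_sqrtr ?ltW // !mob_hp // => lt.
apply: ball_hp; rewrite ?mact_nonzero // wedge_mact cabsM exprMn -/D.
have lx := low x; have ly := low y.
have := nsq_gt0 x; have := nsq_gt0 y; rewrite x0 y0 => ny nx.
have big : D ^+ 2 * (nsq x * nsq y) <= K ^+ 2 * (nsq (mact m x) * nsq (mact m y)).
  have -> : D ^+ 2 * (nsq x * nsq y) = (D * nsq x) * (D * nsq y) by ring.
  have -> : K ^+ 2 * (nsq (mact m x) * nsq (mact m y)) =
    (K * nsq (mact m x)) * (K * nsq (mact m y)) by ring.
  by apply: ler_pM => //; rewrite mulr_ge0 ?nsq_ge0 // sqr_ge0.
have K2 : 0 < K ^+ 2 by rewrite exprn_gt0.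
rewrite -(ltr_pM2l K2).
apply: (@lt_le_trans _ _ (e ^+ 2 * (D ^+ 2 * (nsq x * nsq y)))); last first.
  by rewrite [leRHS]mulrCA ler_pM2l // exprn_gt0.
have -> : K ^+ 2 * (4 * (D * cabs (wedge x y) ^+ 2)) =
  D * K ^+ 2 * (4 * cabs (wedge x y) ^+ 2) by ring.
have -> : e ^+ 2 * (D ^+ 2 * (nsq x * nsq y)) =
    D * K ^+ 2 * (3 * t * (nsq x * nsq y)).
  by rewrite /t; field; rewrite gt_eqF.
rewrite ltr_pM2l; last by rewrite mulr_gt0.
exact: lt.
Qed.

End ChordalMetric.

(** * Uniform convergence in homogeneous coordinates *)

Section UniformConvergence.
Variables (R : realType) (T : Type) (S : set T).
Local Notation C := R[i].
Implicit Types (h k : nat -> T -> C) (f g l : T -> C) (e : R).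

Definition bounded_on f := exists2 M : R, 0 < M & forall x, S x -> cabs (f x) <= M.

(** Boundedness of the limit makes this notion stable under products. *)
Definition ucvg h f := bounded_on f /\
  forall e, 0 < e -> \forall n \near \oo, forall x, S x -> cabs (h n x - f x) < e.

Lemma ucvg_cst f : bounded_on f -> ucvg (fun=> f) f.
Proof. by split=> // e e0; apply: nearW => n x _; rewrite subrr cabs0. Qed.

Lemma bounded_cst (c : C) : bounded_on (fun=> c).
Proof.
exists (cabs c + 1) => [|x _]; first by rewrite ltr_wpDl ?cabs_ge0.
by rewrite lerDl.
Qed.

Lemma ucvgB h k f g : ucvg h f -> ucvg k g ->
  ucvg (fun n x => h n x - k n x) (fun x => f x - g x).
Proof.
move=> [[M M0 fM] hf] [[N N0 gN] kg]; split.
  exists (M + N) => [|x Sx]; first exact: addr_gt0.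
  by rewrite (le_trans (cabsD _ _)) // cabsN lerD ?fM ?gN.
move=> e e0; have e2 : 0 < e / 2 by rewrite divr_gt0.
apply: filterS2 (hf _ e2) (kg _ e2) => n h1 h2 x Sx.
have -> : h n x - k n x - (f x - g x) = (h n x - f x) + - (k n x - g x) by ring.
rewrite (le_lt_trans (cabsD _ _)) // cabsN.
have := h1 x Sx; have := h2 x Sx; lra.
Qed.

Lemma ucvgM h k f g : ucvg h f -> ucvg k g ->
  ucvg (fun n x => h n x * k n x) (fun x => f x * g x).
Proof.
move=> [[M M0 fM] hf] [[N N0 gN] kg]; split.
  exists (M * N) => [|x Sx]; first exact: mulr_gt0.
  by rewrite cabsM ler_pM ?cabs_ge0 ?fM ?gN.
move=> e e0; pose r := Num.min 1 (e / (2 * (1 + M + N))).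
have MN : 0 < 2 * (1 + M + N) by rewrite mulr_gt0 // !addr_gt0.
have r0 : 0 < r by rewrite lt_min ltr01 divr_gt0.
have r1 : r <= 1 by rewrite ge_min lexx.
have re : r * (1 + M + N) <= e / 2.
  have : r <= e / (2 * (1 + M + N)) by rewrite ge_min lexx orbT.
  by rewrite ler_pdivlMr //; lra.
apply: filterS2 (hf _ r0) (kg _ r0) => n h1 h2 x Sx.
have -> : h n x * k n x - f x * g x =
  (h n x - f x) * (k n x - g x) + ((h n x - f x) * g x + f x * (k n x - g x)) by ring.
have b1 := h1 x Sx; have b2 := h2 x Sx; have b3 := fM x Sx; have b4 := gN x Sx.
rewrite (le_lt_trans (cabsD _ _)) //.
apply: (@le_lt_trans _ _ (r * 1 + (r * N + M * r))); last by lra.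
apply: lerD.
  by rewrite cabsM ler_pM ?cabs_ge0 // ltW // (lt_le_trans b2 r1).
have l1 := ltW b1; have l2 := ltW b2.
by rewrite (le_trans (cabsD _ _)) // !cabsM lerD // ler_pM ?cabs_ge0 //.
Qed.

Lemma ucvgX h f i : ucvg h f -> ucvg (fun n x => h n x ^+ i) (fun x => f x ^+ i).
Proof.
move=> hf; elim: i => [|i IH]; first exact: (ucvg_cst (bounded_cst 1)).
have -> : (fun n x => h n x ^+ i.+1) = (fun n x => h n x * h n x ^+ i).
  by apply/funext => n; apply/funext => x; rewrite exprS.
have -> : (fun x => f x ^+ i.+1) = (fun x => f x * f x ^+ i).
  by apply/funext => x; rewrite exprS.
exact: ucvgM.
Qed.

Lemma ucvg_prod (I : finType) (A : pred I) (h : I -> nat -> T -> C) (f : I -> T -> C) :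
  (forall i, ucvg (h i) (f i)) ->
  ucvg (fun n x => \prod_(i | A i) h i n x) (fun x => \prod_(i | A i) f i x).
Proof.
move=> hf; elim: (index_enum I) => [|i s IH].
  have -> : (fun n x => \prod_(i <- [::] | A i) h i n x) = (fun _ _ => 1).
    by apply/funext => n; apply/funext => x; rewrite big_nil.
  have -> : (fun x => \prod_(i <- [::] | A i) f i x) = (fun=> 1).
    by apply/funext => x; rewrite big_nil.
  exact: (ucvg_cst (bounded_cst 1)).
have -> : (fun n x => \prod_(j <- i :: s | A j) h j n x) = (fun n x =>
    (if A i then h i n x else 1) * \prod_(j <- s | A j) h j n x).
  by apply/funext => n; apply/funext => x; rewrite big_cons; case: ifP; rewrite ?mul1r.
have -> : (fun x => \prod_(j <- i :: s | A j) f j x) = (fun x =>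
    (if A i then f i x else 1) * \prod_(j <- s | A j) f j x).
  by apply/funext => x; rewrite big_cons; case: ifP; rewrite ?mul1r.
apply: ucvgM => //; case: (A i) => //; exact: (ucvg_cst (bounded_cst 1)).
Qed.

Definition bounded_below f := exists2 c : R, 0 < c & forall x, S x -> c <= cabs (f x).

Lemma bounded_belowX f i : bounded_below f -> bounded_below (fun x => f x ^+ i).
Proof.
move=> [c c0 fc]; exists (c ^+ i) => [|x Sx]; first exact: exprn_gt0.
elim: i => [|i IH]; first by rewrite !expr0 cabs1.
by rewrite !exprS cabsM ler_pM ?fc // ltW // exprn_gt0.
Qed.

Lemma bounded_below_prod (I : finType) (A : pred I) (f : I -> T -> C) :
  (forall i, bounded_below (f i)) -> bounded_below (fun x => \prod_(i | A i) f i x).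
Proof.
move=> fl; have /choice[c cP] i : exists c : R, 0 < c /\ forall x, S x -> c <= cabs (f i x).
  by have [c c0 fc] := fl i; exists c.
exists (\prod_(i | A i) c i) => [|x Sx].
  by apply: prodr_gt0 => i _; case: (cP i).
suff [] : 0 <= \prod_(i | A i) c i /\
    \prod_(i | A i) c i <= cabs (\prod_(i | A i) f i x) by [].
apply: (big_ind2 (fun (a : R) (b : C) => 0 <= a /\ a <= cabs b)).
- by rewrite cabs1.
- by move=> a b a' b' [a0 ab] [a'0 ab']; rewrite cabsM mulr_ge0 // ler_pM.
- by move=> i _; have [c0 fc] := cP i; rewrite ltW // fc.
Qed.

(** The chordal distance is a quotient, so its numerator being small suffices as
soon as the norms in its denominator are bounded away from zero. *)
Lemma hp_ucvg (G : nat -> T -> C * C) (g : T -> C * C) :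
  ucvg (fun n x => (G n x).1) (fun x => (g x).1) ->
  ucvg (fun n x => (G n x).2) (fun x => (g x).2) ->
  bounded_below (fun x => (g x).1) \/ bounded_below (fun x => (g x).2) ->
  forall e, 0 < e -> \forall n \near \oo, forall x, S x ->
    nonzero (G n x) /\ ball (hp (g x)) e (hp (G n x)).
Proof.
move=> [[M M0 gM] G1] [[N N0 gN] G2] low e e0.
have [c c0 gc] : exists2 c : R, 0 < c & forall x, S x ->
    c <= cabs (g x).1 \/ c <= cabs (g x).2.
  by case: low => -[c c0 gc]; exists c => // x Sx; [left|right]; apply: gc.
pose r := Num.min (c / 2) (e * c ^+ 2 / (8 * (M + N))).
have MN : 0 < 8 * (M + N) by rewrite mulr_gt0 // addr_gt0.
have r0 : 0 < r by rewrite lt_min !divr_gt0 // mulr_gt0 // exprn_gt0.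
have rc : r <= c / 2 by rewrite ge_min lexx.
have re : r * (M + N) * 8 <= e * c ^+ 2.
  have : r <= e * c ^+ 2 / (8 * (M + N)) by rewrite ge_min lexx orbT.
  by rewrite ler_pdivlMr //; lra.
apply: filterS2 (G1 _ r0) (G2 _ r0) => n h1 h2 x Sx.
have {h1} h1 := h1 x Sx; have {h2} h2 := h2 x Sx.
have {gM} gM := gM x Sx; have {gN} gN := gN x Sx.
have nearby (u v : C) : cabs (u - v) < r -> c <= cabs v -> c / 2 <= cabs u.
  move=> uv cv; have := cabsD (v - u) u; rewrite subrK.
  have := cabsN (u - v); rewrite opprB; lra.
have [ng nG] : c ^+ 2 <= nsq (g x) /\ (c / 2) ^+ 2 <= nsq (G n x).
  have sq (u v : R) : 0 < u -> u <= v -> u ^+ 2 <= v ^+ 2.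
    by move=> u0 uv; rewrite ler_pXn2r // nnegrE ?ltW // (lt_le_trans u0).
  have c20 : 0 < c / 2 by rewrite divr_gt0.
  have [] := gc x Sx => cg; split; rewrite /nsq.
  - by rewrite (le_trans (sq _ _ c0 cg)) // lerDl sqr_ge0.
  - by rewrite (le_trans (sq _ _ c20 (nearby _ _ h1 cg))) // lerDl sqr_ge0.
  - by rewrite (le_trans (sq _ _ c0 cg)) // lerDr sqr_ge0.
  - by rewrite (le_trans (sq _ _ c20 (nearby _ _ h2 cg))) // lerDr sqr_ge0.
have c20 : 0 < (c / 2) ^+ 2 by rewrite exprn_gt0 // divr_gt0.
have nzG : nonzero (G n x) by rewrite -nsq_gt0 (lt_le_trans c20).
have nzg : nonzero (g x) by rewrite -nsq_gt0 (lt_le_trans _ ng) // exprn_gt0.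
split=> //; apply: ball_hp => //.
have W : cabs (wedge (g x) (G n x)) <= r * (M + N).
  have -> : wedge (g x) (G n x) =
      (g x).1 * ((G n x).2 - (g x).2) + - ((g x).2 * ((G n x).1 - (g x).1)).
    by rewrite /wedge; ring.
  rewrite (le_trans (cabsD _ _)) // cabsN !cabsM mulrDr [r * M]mulrC [r * N]mulrC.
  by rewrite lerD // ler_pM ?cabs_ge0 // ltW.
have W2 : cabs (wedge (g x) (G n x)) ^+ 2 <= (r * (M + N)) ^+ 2.
  by rewrite ler_pXn2r // nnegrE ?cabs_ge0 // mulr_ge0 ?ltW // addr_gt0.
have rM2 : (r * (M + N) * 8) ^+ 2 <= (e * c ^+ 2) ^+ 2.
  rewrite ler_pXn2r // nnegrE; last by rewrite mulr_ge0 ?sqr_ge0 // ltW.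
  by rewrite !mulr_ge0 // ltW // addr_gt0.
have prod : c ^+ 2 * (c / 2) ^+ 2 <= nsq (g x) * nsq (G n x).
  by rewrite ler_pM // sqr_ge0.
apply: (@lt_le_trans _ _ (e ^+ 2 * (c ^+ 2 * (c / 2) ^+ 2))); last first.
  by rewrite ler_pM2l // exprn_gt0.
have : 0 < (e * c ^+ 2) ^+ 2 by rewrite exprn_gt0 // mulr_gt0 // exprn_gt0.
have -> : e ^+ 2 * (c ^+ 2 * (c / 2) ^+ 2) = (e * c ^+ 2) ^+ 2 / 4 by field.
move: W2 rM2; rewrite [(_ * 8) ^+ 2]exprMn; lra.
Qed.

End UniformConvergence.

(** * Cross-ratios and limits of points *)

Section ProjectiveLimits.
Variable R : realType.
Local Notation C := R[i].
Implicit Types (x y : C * C) (p q : P1 R) (e : R).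

Definition lift_cvg (b : nat -> C * C) x := forall e, 0 < e ->
  \forall n \near \oo, cabs ((b n).1 - x.1) < e /\ cabs ((b n).2 - x.2) < e.

Lemma lift_cvg_ucvg (T : Type) (S : set T) b x : lift_cvg b x ->
  ucvg S (fun n _ => (b n).1) (fun=> x.1) /\ ucvg S (fun n _ => (b n).2) (fun=> x.2).
Proof.
move=> bx; split; (split; first exact: bounded_cst) => e e0;
  by apply: filterS (bx e e0) => n [].
Qed.

Lemma lagrange x y :
  cabs (x.1 * conjc y.1 + x.2 * conjc y.2) ^+ 2 + cabs (wedge x y) ^+ 2 = nsq x * nsq y.
Proof.
by case: x y => [[a b] [c d]] [[a' b'] [c' d']]; rewrite /nsq !cabs_sqr /wedge /=; ring.
Qed.

(** The lifts are scaled to have the same inner product with [y = hlift p] as [y]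
itself. Their difference from [y] is then orthogonal to [y], so by [lagrange] its
norm is governed by the [wedge] with [y], that is, by the chordal distance. *)
Lemma P1_cvg_lift (p_ : nat -> P1 R) p : p_ @ \oo --> p ->
  exists b : nat -> C * C, (forall n, nonzero (b n) /\ hp (b n) = p_ n) /\
    lift_cvg b (hlift p).
Proof.
move=> cvp; pose y := hlift p; pose N : C := y.1 * conjc y.1 + y.2 * conjc y.2.
have N2 : cabs N ^+ 2 = nsq y ^+ 2.
  by have := lagrange y y; rewrite wedgexx cabs0 expr0n addr0.
have y1 : 1 <= nsq y := nsq_hlift p.
have N0 : N != 0.
  rewrite -cabs_eq0 -sqrf_eq0 N2 sqrf_eq0 gt_eqF //; lra.
pose t n := (hlift (p_ n)).1 * conjc y.1 + (hlift (p_ n)).2 * conjc y.2.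
pose b n := if t n == 0 then hlift (p_ n) else scale (N / t n) (hlift (p_ n)).
have bP n : nonzero (b n) /\ hp (b n) = p_ n.
  rewrite /b; case: eqP => [_|/eqP t0]; first by rewrite lift_nonzero hp_lift.
  have k0 : N / t n != 0 by rewrite mulf_neq0 // invr_eq0.
  by rewrite nonzero_scale ?lift_nonzero // hp_scale // hp_lift.
exists b; split=> // e e0.
(* [s] is the chordal radius for which [ball_wedge] gives the bound [r]. *)
pose r := Num.min 1 (e ^+ 2 / (2 * nsq y)).
have y2 : 0 < 2 * nsq y by lra.
have r0 : 0 < r by rewrite lt_min ltr01 divr_gt0 // exprn_gt0.
have r1 : r <= 1 by rewrite ge_min lexx.
have re : r * (2 * nsq y) <= e ^+ 2.
  by rewrite -ler_pdivlMr // ge_min lexx orbT.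
pose s := Num.sqrt (r / 3); have s0 : 0 < s by rewrite sqrtr_gt0 divr_gt0.
move/cvg_ballP: cvp => /(_ s s0); apply: filterS => n bn.
have [b0 hb] := bP n.
have Wlt : 4 * cabs (wedge y (b n)) ^+ 2 < r * (nsq y * nsq (b n)).
  have := @ball_wedge R y (b n) s (lift_nonzero p) b0.
  rewrite hp_lift hb => /(_ bn); rewrite sqr_sqrtr; last by rewrite ltW // divr_gt0.
  by have -> : 3 * (r / 3) = r by field.
have W : cabs (wedge y (b n)) = cabs (wedge (b n) y).
  by rewrite -cabsN; congr cabs; rewrite /wedge; ring.
rewrite {}W in Wlt.
have L := lagrange (b n) y.
have nb : 0 < nsq (b n) by rewrite nsq_gt0.
have t0 : t n != 0.
  apply/eqP => tn0; move: L Wlt; rewrite /b tn0 eqxx -/(t n) tn0 cabs0 expr0n /= add0r => ->.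
  have := lift_nonzero (p_ n); rewrite -nsq_gt0 => np.
  have : 0 < nsq (hlift (p_ n)) * nsq y by rewrite mulr_gt0 //; lra.
  rewrite [nsq y * _]mulrC; nra.
have inn : (b n).1 * conjc y.1 + (b n).2 * conjc y.2 = N.
  by rewrite /b (negPf t0) /=; transitivity (N / t n * t n); [rewrite /t; ring|rewrite divfK].
rewrite inn N2 in L.
pose D := ((b n).1 - y.1, (b n).2 - y.2).
have LD := lagrange D y.
have WD : wedge D y = wedge (b n) y by rewrite /wedge /=; ring.
have ID : D.1 * conjc y.1 + D.2 * conjc y.2 = 0.
  rewrite -[RHS](subrr N) -[X in _ = X - _]inn /N /=; ring.
rewrite ID WD cabs0 expr0n add0r in LD.
have De : nsq D < e ^+ 2.
  have yy : 0 < nsq y by lra.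
  rewrite -(ltr_pM2r yy) -LD.
  move: Wlt; rewrite [nsq y * _]mulrC -L.
  have := sqr_ge0 (cabs (wedge (b n) y)).
  move: re yy r0 r1; move: (cabs _ ^+ 2) (nsq y) (e ^+ 2) => W Y E re yy r0 r1 W0 lt.
  have rW : r * W <= W by rewrite ler_piMl.
  have rY : r * (2 * Y) * Y <= E * Y by rewrite ler_pM2r.
  have : 0 < r * Y ^+ 2 by rewrite mulr_gt0 // exprn_gt0.
  move: lt rY; rewrite mulrDr; nra.
have := cabs_ge0 D.1; have := cabs_ge0 D.2; move: De; rewrite /nsq.
rewrite /=; move: (cabs _) (cabs _) => u v De v0 u0.
by split; rewrite -(ltr_pXn2r (n := 2)) ?nnegrE ?(ltW e0) //;
  have := sqr_ge0 u; have := sqr_ge0 v; lra.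
Qed.

Lemma hp_cvg (G : nat -> C * C) x : nonzero x ->
  ucvg [set: unit] (fun n _ => (G n).1) (fun=> x.1) ->
  ucvg [set: unit] (fun n _ => (G n).2) (fun=> x.2) ->
  (\forall n \near \oo, nonzero (G n)) /\ (fun n => hp (G n)) @ \oo --> hp x.
Proof.
move=> x0 G1 G2.
have low : bounded_below [set: unit] (fun=> x.1) \/ bounded_below [set: unit] (fun=> x.2).
  by case/orP: x0 => x0; [left; exists (cabs x.1)|right; exists (cabs x.2)];
    rewrite ?cabs_gt0.
have H := @hp_ucvg R unit setT (fun n _ => G n) (fun=> x) G1 G2 low.
split; first by apply: filterS (H 1 ltr01) => n /(_ tt I)[].
by apply/cvg_ballP => e e0; apply: filterS (H e e0) => n /(_ tt I)[].
Qed.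

Lemma mob_cvg (m : mobius R) (p_ : nat -> P1 R) p :
  p_ @ \oo --> p -> (fun n => m (p_ n)) @ \oo --> m p.
Proof.
move=> /cvg_ballP cvp; apply/cvg_ballP => e e0.
have [r r0 mr] := mob_unif m e0.
by apply: filterS (cvp r r0) => n; exact: mr.
Qed.

Definition cross x0 x1 xoo x : C * C :=
  (wedge x x0 * wedge x1 xoo, wedge x xoo * wedge x1 x0).

Lemma hproj0 (v : C) : v != 0 -> hproj 0 v = Some 0 :> P1 R.
Proof. by move=> v0; rewrite /hproj (negPf v0) mul0r. Qed.
Lemma hproj_inf (u : C) : hproj u 0 = None :> P1 R.
Proof. by rewrite /hproj eqxx. Qed.
Lemma hproj1 (v : C) : v != 0 -> hproj v v = Some 1 :> P1 R.
Proof. by move=> v0; rewrite /hproj (negPf v0) divff. Qed.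

Lemma cross_nonzero x0 x1 xoo x : nonzero x0 -> nonzero x1 -> nonzero xoo ->
  nonzero x -> hp x0 != hp x1 -> hp x0 != hp xoo -> hp x1 != hp xoo ->
  nonzero (cross x0 x1 xoo x).
Proof.
move=> n0 n1 noo n h01 h0oo h1oo; rewrite /nonzero /cross /=.
rewrite !mulf_eq0 !wedge_eq0 // (negPf h1oo) [hp x1 == _]eq_sym (negPf h01) !orbF.
by case: eqP => [->|].
Qed.

(** Both coordinates of a normalizing transformation are linear forms, one of
which vanishes at [x0] and the other at [xoo]; so they are multiples of
[wedge x x0] and [wedge x xoo], and the value at [x1] fixes their ratio. *)
Lemma normalizationE x0 x1 xoo x : nonzero x0 -> nonzero x1 -> nonzero xoo ->
  nonzero x -> hp x0 != hp x1 -> hp x0 != hp xoo -> hp x1 != hp xoo ->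
  normalization (hp x0) (hp x1) (hp xoo) (hp x) = hp (cross x0 x1 xoo x).
Proof.
move=> n0 n1 noo n h01 h0oo h1oo.
have W10 : wedge x1 x0 != 0 by rewrite wedge_eq0 // eq_sym.
have W1oo : wedge x1 xoo != 0 by rewrite wedge_eq0.
have W0oo : wedge x0 xoo != 0 by rewrite wedge_eq0.
have Woo0 : wedge xoo x0 != 0 by rewrite wedge_eq0 // eq_sym.
have det : (x0.2 * wedge x1 xoo) * (- xoo.1 * wedge x1 x0) -
    (- x0.1 * wedge x1 xoo) * (xoo.2 * wedge x1 x0) != 0.
  have : wedge x1 xoo * wedge x1 x0 * wedge x0 xoo != 0 by rewrite !mulf_neq0.
  by apply: contra => /eqP e; apply/eqP; rewrite -e /wedge; ring.
have mE y : mact (Mobius det) y = cross x0 x1 xoo y.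
  by rewrite /mact /cross /wedge /=; congr pair; ring.
have ex : exists m : mobius R, [/\ m (hp x0) = Some 0, m (hp x1) = Some 1 & m (hp xoo) = None].
  exists (Mobius det); rewrite !mob_hp // !mE /cross !wedgexx !mul0r.
  split; [apply: hproj0|rewrite /hp /= [wedge x1 x0 * _]mulrC; apply: hproj1|exact: hproj_inf];
    by rewrite mulf_neq0.
have := xgetPex (mob_id R) ex; rewrite -/(normalization _ _ _).
move: (normalization _ _ _) => m [].
have some (u v t : C) : hproj u v = Some t :> P1 R -> u = t * v /\ v != 0.
  by rewrite /hproj; case: eqP => // /eqP v0 [<-]; rewrite divfK.
rewrite !mob_hp // /hp /= => /some[l0 _] /some[l1 t0].
rewrite /hproj; case: eqP => // loo _; rewrite -!/(hproj _ _).
rewrite mul0r in l0; rewrite mul1r in l1.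
set t := mob_c m * x1.1 + mob_d m * x1.2 in t0 l1.
have k0 : wedge x1 x0 * wedge x1 xoo != 0 by rewrite mulf_neq0.
rewrite -(hproj_scale _ _ k0) -(hproj_scale (wedge x x0 * _) _ t0).
congr hproj.
  transitivity (wedge x1 xoo * (wedge x x0 * (mob_a m * x1.1 + mob_b m * x1.2) +
    wedge x1 x * (mob_a m * x0.1 + mob_b m * x0.2))); first by rewrite /wedge; ring.
  by rewrite l0 l1; ring.
transitivity (wedge x1 x0 * (wedge x xoo * t +
  wedge x1 x * (mob_c m * xoo.1 + mob_d m * xoo.2))); first by rewrite /t /wedge; ring.
by rewrite loo; ring.
Qed.

Lemma normalization_mob (m : mobius R) p0 p1 poo p :
  p0 != p1 -> p0 != poo -> p1 != poo ->
  normalization (m p0) (m p1) (m poo) (m p) = normalization p0 p1 poo p.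
Proof.
rewrite -(hp_lift p0) -(hp_lift p1) -(hp_lift poo) -(hp_lift p).
move: (lift_nonzero p0) (lift_nonzero p1) (lift_nonzero poo) (lift_nonzero p).
move: (hlift p0) (hlift p1) (hlift poo) (hlift p) => x0 x1 xoo x n0 n1 noo n h01 h0oo h1oo.
have inj := inj_eq (@mob_inj R m).
rewrite [in RHS]normalizationE // (mob_hp m n0) (mob_hp m n1) (mob_hp m noo) (mob_hp m n).
rewrite normalizationE ?mact_nonzero // -?mob_hp // ?inj //.
have D0 : mdet m ^+ 2 != 0 by rewrite expf_neq0 // mdet_neq0.
rewrite -[in RHS](hp_scale _ D0); congr hp.
by rewrite /cross /scale !wedge_mact /=; congr pair; ring.
Qed.

Lemma ucvg_wedge (T : Type) (S : set T) (a b : nat -> T -> C * C)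
    (f g : T -> (C * C)%type) :
  ucvg S (fun n t => (a n t).1) (fun t => (f t).1) ->
  ucvg S (fun n t => (a n t).2) (fun t => (f t).2) ->
  ucvg S (fun n t => (b n t).1) (fun t => (g t).1) ->
  ucvg S (fun n t => (b n t).2) (fun t => (g t).2) ->
  ucvg S (fun n t => wedge (a n t) (b n t)) (fun t => wedge (f t) (g t)).
Proof. by move=> a1 a2 b1 b2; apply: ucvgB; apply: ucvgM. Qed.

Lemma normalization_cvg (q0 q1 qoo q : nat -> P1 R) p0 p1 poo p :
  p0 != p1 -> p0 != poo -> p1 != poo ->
  (forall n, [/\ q0 n != q1 n, q0 n != qoo n & q1 n != qoo n]) ->
  q0 @ \oo --> p0 -> q1 @ \oo --> p1 -> qoo @ \oo --> poo -> q @ \oo --> p ->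
  (fun n => normalization (q0 n) (q1 n) (qoo n) (q n)) @ \oo --> normalization p0 p1 poo p.
Proof.
move=> h01 h0oo h1oo hq /P1_cvg_lift[b0 [b0P c0]] /P1_cvg_lift[b1 [b1P c1]].
move=> /P1_cvg_lift[boo [booP coo]] /P1_cvg_lift[b [bP c]].
have -> : (fun n => normalization (q0 n) (q1 n) (qoo n) (q n)) =
    (fun n => hp (cross (b0 n) (b1 n) (boo n) (b n))).
  apply/funext => n; have [m01 m0oo m1oo] := hq n.
  have [[n0 e0] [n1 e1]] := (b0P n, b1P n); have [[noo eoo] [nx ex]] := (booP n, bP n).
  by rewrite -normalizationE ?e0 ?e1 ?eoo ?ex.
rewrite -(hp_lift p0) -(hp_lift p1) -(hp_lift poo) -(hp_lift p).
rewrite normalizationE ?lift_nonzero ?hp_lift //.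
have [u0 v0] := lift_cvg_ucvg [set: unit] c0.
have [u1 v1] := lift_cvg_ucvg [set: unit] c1.
have [uoo voo] := lift_cvg_ucvg [set: unit] coo.
have [u v] := lift_cvg_ucvg [set: unit] c.
apply: (hp_cvg _ _ _).2.
- by apply: cross_nonzero; rewrite ?lift_nonzero ?hp_lift.
- by apply: ucvgM; apply: ucvg_wedge.
- by apply: ucvgM; apply: ucvg_wedge.
Qed.

End ProjectiveLimits.

(** * Convergence in the moduli space *)

Lemma initial_cvgP (A : choiceType) (B : topologicalType) (f : A -> B)
    (G : set_system A) (a : A) : Filter G ->
  G --> (a : initial_topology f) <-> f @ G --> f a.
Proof.
move=> FG; split=> [Ga|fGa].
  by apply: cvg_comp Ga _; exact: (@initial_continuous _ _ f).
move=> U /=; rewrite nbhsE => -[W [[V oV <-] Va] WU].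
have /fGa : nbhs (f a) V by apply: open_nbhs_nbhs.
by move=> GV; apply: filterS WU GV.
Qed.

Lemma ptws_cvgP (A : Type) (B : topologicalType) (G : set_system {ptws A -> B})
    (f : {ptws A -> B}) : Filter G ->
  G --> f <-> forall a, (fun g : {ptws A -> B} => g a) @ G --> f a.
Proof.
move=> FG; rewrite cvg_sup; split=> h a.
  by have /(@initial_cvgP _ _ (fun g : {ptws A -> B} => g a) G f FG) := h a.
by apply/(@initial_cvgP _ _ (fun g : {ptws A -> B} => g a) G f FG); exact: h.
Qed.

Section TreeLimits.
Variables (R : realType) (X : finType).
Implicit Types T : stree R X.

Lemma alphaE T (v : 'I_(nint T)) (x0 x1 xoo x : X) :
  uniq [:: toward v x0; toward v x1; toward v xoo] ->
  alpha T x0 x1 xoo x =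
  normalization (marking v x0) (marking v x1) (marking v xoo) (marking v x).
Proof. by move=> uv; rewrite /alpha (tripodE uv). Qed.

Lemma marking_neq T (v : 'I_(nint T)) (x y : X) :
  toward v x != toward v y -> marking v x != marking v y.
Proof.
by apply: contra => /eqP e; apply/eqP; apply: (pt_inj (v := v)) e; exact: toward_adj.
Qed.

Lemma uniq3 (E : eqType) (a b c : E) :
  uniq [:: a; b; c] -> [/\ a != b, a != c & b != c].
Proof. by rewrite /= !inE negb_or andbT => /andP[/andP[-> ->] ->]. Qed.

(** An isomorphism carries paths to paths, and does not use the removed edge. *)
Lemma toward_iso T1 T2 (J : stree_iso T1 T2) (v : 'I_(nint T1)) x :
  toward (tm_int (si_map J) v) x = tm_vert (si_map J) (toward v x).
Proof.
set M := si_map J; have Minj : injective (tm_vert M) by exact: bij_inj (si_bij J).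
have Mv : adj (inl (tm_int M v)) (tm_vert M (toward v x)).
  exact: (@tm_adj _ _ _ _ M _ _ (toward_adj v x)).
apply/eqP; rewrite -(towardE x Mv).
have := toward_branch v x; rewrite /branch => /connectP[p pp xE].
apply/connectP; exists (map (tm_vert M) p); last first.
  by rewrite last_map -xE /= si_leaf.
rewrite path_map; apply: sub_path pp => a b; rewrite /cut /=.
case/andP=> /(@tm_adj _ _ _ _ M) -> /=.
by rewrite -[inl (tm_int M v)]/(tm_vert M (inl v)) !(inj_eq Minj).
Qed.

Lemma stree_alpha_iso T1 T2 (J : stree_iso T1 T2) : stree_alpha T1 = stree_alpha T2.
Proof.
apply/funext => -[q uq]; rewrite /stree_alpha /=.
have /tuple_uniqP inj := uq.
have neq i j : i != j -> tnth q i != tnth q j by apply: contra => /eqP/inj->.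
have [v uv] := tripod_exists T1 (neq 0 1 isT) (neq 0 2%:R isT) (neq 1 2%:R isT).
have Minj : injective (tm_vert (si_map J)) by exact: bij_inj (si_bij J).
have uv' : uniq [:: toward (tm_int (si_map J) v) (tnth q 0);
    toward (tm_int (si_map J) v) (tnth q 1);
    toward (tm_int (si_map J) v) (tnth q 2%:R)].
  by rewrite !toward_iso -[[:: _; _; _]]/(map (tm_vert (si_map J)) [:: _; _; _]) map_inj_uniq.
rewrite (alphaE _ uv) (alphaE _ uv').
have mark x : marking (tm_int (si_map J) v) x = si_mob J v (marking v x).
  by rewrite /marking toward_iso si_pt // toward_adj.
have [/marking_neq h1 /marking_neq h2 /marking_neq h3] := uniq3 uv.
by rewrite !mark normalization_mob.
Qed.

Lemma mod_embed_class T : mod_embed (mod_class T) = stree_alpha T.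
Proof.
rewrite /mod_embed.
have /eqmodP/asboolP[J] :
  mod_class (repr (mod_class T : {eq_quot @stree_isob R X}%qT)) = mod_class T.
  exact: reprK.
exact: stree_alpha_iso J.
Qed.

Lemma mod_cvgP (T_ : nat -> stree R X) T :
  (fun n => mod_class (T_ n)) @ \oo --> mod_class T <->
  forall q, (fun n => stree_alpha (T_ n) q) @ \oo --> stree_alpha T q.
Proof.
have -> : (fun n => mod_class (T_ n)) @ \oo --> mod_class T <->
    (fun n => stree_alpha (T_ n)) @ \oo --> stree_alpha T.
  rewrite -mod_embed_class.
  have -> : (fun n => stree_alpha (T_ n)) = @mod_embed R X \o (fun n => mod_class (T_ n)).
    by apply/funext => n /=; rewrite mod_embed_class.
  exact: (@initial_cvgP _ _ (@mod_embed R X)).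
exact: ptws_cvgP.
Qed.

Lemma one_vertex T (h : nint T = 1%N) (v w : 'I_(nint T)) : v = w.
Proof. by apply: ord_inj; case: v w => [i +] [j +] /=; rewrite h; case: i j => [|?] [|?]. Qed.

Lemma one_vertex_toward T (h : nint T = 1%N) (v : 'I_(nint T)) x : toward v x = inr x.
Proof.
have := toward_branch v x; have := toward_adj v x.
case: (toward v x) => [w|y] vw; first by rewrite (one_vertex h w v) adj_irr in vw.
by rewrite leaf_branch // => /eqP ->.
Qed.

End TreeLimits.

(** * Convergence of covers *)

Section FormLimits.
Variable R : realType.
Local Notation C := R[i].

Lemma P1_avoid (s : seq (P1 R)) : exists x : C * C,
  nonzero x /\ forall p, p \in s -> wedge x (hlift p) != 0.
Proof.
have [w ws] : exists w : C, Some w \notin s.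
  apply: contrapT => none.
  have all_in (w : C) : (Some w : P1 R) \in s.
    by apply/negPn/negP => nw; apply: none; exists w.
  pose t := [seq (Some k%:R : P1 R) | k <- iota 0 (size s).+1].
  have : (size t <= size s)%N.
    apply: uniq_leq_size => [|p /mapP[k _ ->]]; last exact: all_in.
    rewrite map_inj_uniq ?iota_uniq // => i j [/eqP].
    by rewrite eqr_nat => /eqP.
  by rewrite size_map size_iota ltnn.
exists (w, 1); split; first by rewrite /nonzero /= oner_eq0 orbT.
move=> p ps; rewrite -[(w, 1)]/(hlift (Some w)) wedge_lift_eq0.
by apply: contraNneq ws => ->.
Qed.

Lemma fiber_finite (f : ratmap R) q : exists s : seq (P1 R), forall p, f p = q -> p \in s.
Proof.
have [r hE] := closed_field_poly_normal (rm_fiber f q).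
exists (None :: map Some r) => p /eqP; rewrite rm_fun_fiber inE.
case: p => [w|//]; rewrite hE rootZ ?lead_coef_eq0 ?rm_fiber_neq0 // root_prod_XsubC => wr.
by rewrite map_f // orbT.
Qed.

Lemma P1_lift_bounded (p : P1 R) : exists2 x : C * C, hp x = p &
  [/\ cabs x.1 <= 1, cabs x.2 <= 1 & 1 <= nsq x].
Proof.
case: p => [w|]; last first.
  exists (1, 0); first exact: hproj_inf.
  by rewrite /nsq /= cabs1 cabs0 expr1n expr0n addr0.
have [le|lt] := leP (cabs w) 1.
  exists (w, 1); first by rewrite -[RHS](hp_lift).
  by split; [exact: le|rewrite cabs1|exact: (nsq_hlift (Some w))].
have w0 : w != 0 by rewrite -cabs_gt0 (lt_trans _ lt).
exists (1, w^-1); first by rewrite /hp /hproj /= invr_eq0 (negPf w0) div1r invrK.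
rewrite /nsq /= cabs1 expr1n cabsV; split=> //; last by rewrite lerDl sqr_ge0.
by rewrite invf_le1 ?ltW // (lt_trans _ lt).
Qed.

Section Forms.
Variables (d : nat) (Y Z : finType) (P : portrait d Y Z).
Variables (b : Y -> nat -> C * C) (b0 : Y -> C * C).
Hypothesis bb0 : forall y, lift_cvg (b y) (b0 y).
Variables (T : Type) (S : set T) (g : T -> C * C).
Hypothesis g1 : bounded_on S (fun t => (g t).1).
Hypothesis g2 : bounded_on S (fun t => (g t).2).

Lemma ucvg_wedge_lift y :
  ucvg S (fun n t => wedge (g t) (b y n)) (fun t => wedge (g t) (b0 y)).
Proof.
have [b1 b2] := lift_cvg_ucvg S (bb0 y).
by apply: (@ucvg_wedge _ _ S (fun _ => g) (fun n _ => b y n) g (fun=> b0 y));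
  rewrite //; apply: ucvg_cst.
Qed.

Lemma ucvg_fiber_form z :
  ucvg S (fun n t => fiber_form P (fun y => b y n) z (g t))
         (fun t => fiber_form P b0 z (g t)).
Proof.
rewrite /fiber_form.
apply: (@ucvg_prod _ _ S Y (fun y => pmap P y == z)
  (fun y n t => wedge (g t) (b y n) ^+ pdeg P y) (fun y t => wedge (g t) (b0 y) ^+ pdeg P y)).
by move=> y; apply: ucvgX; exact: ucvg_wedge_lift.
Qed.

End Forms.

Lemma ucvg_neq0 (T : Type) (S : set T) (h : nat -> T -> C) f :
  ucvg S h f -> bounded_below S f -> \forall n \near \oo, forall t, S t -> h n t != 0.
Proof.
move=> [_ hf] [c c0 fc]; apply: filterS (hf c c0) => n hn t St.
apply/eqP => h0; have := hn t St; rewrite h0 sub0r cabsN => lt.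
by have := fc t St; rewrite leNgt lt.
Qed.

(** Otherwise [hp x] would be within [r] of [hp y], by [ball_hp]. *)
Lemma wedge_near (x y : C * C) (p : P1 R) (r : R) : 0 < r -> 1 <= nsq y -> 1 <= nsq x ->
  ~ ball p (2 * r) (hp y) -> ball p r (hp x) -> r / 2 <= cabs (wedge x y).
Proof.
move=> r0 y1 x1 far close; rewrite leNgt; apply/negP => lt; apply: far.
have [x0 y0] : nonzero x /\ nonzero y by rewrite -!nsq_gt0; split; lra.
rewrite mulrDl mul1r; apply: ball_triangle close _; apply: ball_hp => //.
have W : cabs (wedge x y) ^+ 2 < (r / 2) ^+ 2.
  by rewrite ltr_pXn2r // nnegrE ?cabs_ge0 // ltW // divr_gt0.
apply: (@lt_le_trans _ _ (r ^+ 2)); first by move: W; rewrite exprMn; lra.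
by rewrite ler_peMr ?sqr_ge0 // mulr_ege1.
Qed.

End FormLimits.

Section SourceRescaling.
Variables (R : realType) (d : nat) (Y Z : finType) (P : portrait d Y Z).
Variables (Fn : nat -> RatF R P) (F : RatHat R P).
Local Notation C := R[i].

Lemma rf_aY_inj n x y : x != y -> rf_aY (Fn n) x != rf_aY (Fn n) y.
Proof.
move=> xy; apply: marking_neq; rewrite !(one_vertex_toward (rf_src (Fn n))).
by apply: contra xy => /eqP[->].
Qed.

Lemma Imap_cvgP :
  ((fun n => Imap (cover_class (Fn n))) @ \oo --> Imap (cover_class F)) <->
  forall q, (fun n => stree_alpha (tc_src (Fn n)) q) @ \oo --> stree_alpha (tc_src F) q.
Proof.
rewrite ImapE; have -> : (fun n => Imap (cover_class (Fn n))) =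
    (fun n => mod_class (tc_src (Fn n))) by apply/funext => n; rewrite ImapE.
exact: mod_cvgP.
Qed.

(** At the only vertex, each leaf is its own direction. *)
Lemma alpha_rf n x0 x1 xoo x : uniq [:: x0; x1; xoo] ->
  alpha (tc_src (Fn n)) x0 x1 xoo x =
  normalization (rf_aY (Fn n) x0) (rf_aY (Fn n) x1) (rf_aY (Fn n) xoo) (rf_aY (Fn n) x).
Proof.
move=> u3; apply: alphaE; rewrite !(one_vertex_toward (rf_src (Fn n))).
have inr_inj : injective (fun y => inr y : vertex (tc_src (Fn n))) by move=> ? ? [].
by rewrite -[[:: inr _; _; _]]/(map (fun y => inr y : vertex (tc_src (Fn n))) [:: _; _; _])
  map_inj_uniq.
Qed.

Lemma Imap_cvg_of_ts_converges : ts_converges Fn F ->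
  (fun n => Imap (cover_class (Fn n))) @ \oo --> Imap (cover_class F).
Proof.
move=> conv; apply/Imap_cvgP => -[q uq]; rewrite /stree_alpha /=.
have /tuple_uniqP inj := uq.
have neq i j : i != j -> tnth q i != tnth q j by apply: contra => /eqP/inj->.
move: (neq 0 1 isT) (neq 0 2%:R isT) (neq 1 2%:R isT) => {neq inj uq}.
move: (tnth q 0) (tnth q 1) (tnth q 2%:R) (tnth q 3%:R) => x0 x1 xoo x h01 h0oo h1oo.
have [v uv] := tripod_exists (tc_src F) h01 h0oo h1oo.
have [phiY [phiZ [cY _ _]]] := conv v.
rewrite (alphaE _ uv).
have [/marking_neq m01 /marking_neq m0oo /marking_neq m1oo] := uniq3 uv.
have u3 : uniq [:: x0; x1; xoo] by rewrite /= !inE negb_or h01 h0oo h1oo.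
have -> : (fun n => alpha (tc_src (Fn n)) x0 x1 xoo x) = (fun n =>
    normalization (phiY n (rf_aY (Fn n) x0)) (phiY n (rf_aY (Fn n) x1))
      (phiY n (rf_aY (Fn n) xoo)) (phiY n (rf_aY (Fn n) x))).
  apply/funext => n; rewrite alpha_rf //.
  by rewrite normalization_mob ?rf_aY_inj.
apply: normalization_cvg => // n.
by rewrite !(inj_eq (@mob_inj R _)) !rf_aY_inj.
Qed.

Lemma normalization_fix (p0 p1 poo : P1 R) : p0 != p1 -> p0 != poo -> p1 != poo ->
  [/\ normalization p0 p1 poo p0 = Some 0, normalization p0 p1 poo p1 = Some 1 &
      normalization p0 p1 poo poo = None].
Proof.
rewrite -(hp_lift p0) -(hp_lift p1) -(hp_lift poo).
move: (lift_nonzero p0) (lift_nonzero p1) (lift_nonzero poo).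
move: (hlift p0) (hlift p1) (hlift poo) => x0 x1 xoo n0 n1 noo h01 h0oo h1oo.
rewrite !normalizationE // /cross !wedgexx !mul0r /hp /= [wedge x1 x0 * _]mulrC.
split; [apply: hproj0|apply: hproj1|exact: hproj_inf];
  by rewrite mulf_neq0 // wedge_eq0 // eq_sym.
Qed.

(** Normalize with respect to a triple of leaves separated by [v], then undo the
normalization of the limit. The coordinates alpha_t are exactly the normalized
marked points, except for those of the triple itself, which are constant. *)
Lemma source_rescaling (v : 'I_(nint (tc_src F))) :
  (fun n => Imap (cover_class (Fn n))) @ \oo --> Imap (cover_class F) ->
  exists phi : nat -> mobius R,
    forall y, (fun n => phi n (rf_aY (Fn n) y)) @ \oo --> marking v y.
Proof.
move/Imap_cvgP => cvgI.
have [x0 [x1 [xoo uv]]] := tripod_of_vertex v.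
have [t01 t0oo t1oo] := uniq3 uv.
have h01 : x0 != x1 by apply: contra t01 => /eqP ->.
have h0oo : x0 != xoo by apply: contra t0oo => /eqP ->.
have h1oo : x1 != xoo by apply: contra t1oo => /eqP ->.
have u3 : uniq [:: x0; x1; xoo] by rewrite /= !inE negb_or h01 h0oo h1oo.
pose s := normalization (marking v x0) (marking v x1) (marking v xoo).
pose sn n := normalization (rf_aY (Fn n) x0) (rf_aY (Fn n) x1) (rf_aY (Fn n) xoo).
have [s0 s1 soo] := normalization_fix (marking_neq t01) (marking_neq t0oo) (marking_neq t1oo).
have snP n := normalization_fix (rf_aY_inj n h01) (rf_aY_inj n h0oo) (rf_aY_inj n h1oo).
have key y : (fun n => sn n (rf_aY (Fn n) y)) @ \oo --> s (marking v y).
  have [->|y0] := eqVneq y x0.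
    rewrite /s s0; under eq_fun do rewrite /sn (let: And3 e _ _ := snP _ in e).
    exact: cvg_cst.
  have [->|y1] := eqVneq y x1.
    rewrite /s s1; under eq_fun do rewrite /sn (let: And3 _ e _ := snP _ in e).
    exact: cvg_cst.
  have [->|yoo] := eqVneq y xoo.
    rewrite /s soo; under eq_fun do rewrite /sn (let: And3 _ _ e := snP _ in e).
    exact: cvg_cst.
  have uq : uniq [tuple x0; x1; xoo; y].
    by move: u3; rewrite /= !inE !negb_or !andbT ![_ == y]eq_sym y0 y1 yoo !andbT.
  have := cvgI (Sub [tuple x0; x1; xoo; y] uq).
  rewrite /stree_alpha /= !(tnth_nth x0) /= (alphaE _ uv).
  by under eq_fun do rewrite alpha_rf //.
exists (fun n => mob_comp (mob_inv s) (sn n)) => y.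
under eq_fun do rewrite mob_compE.
by rewrite -[marking v y](mob_invK s); apply: mob_cvg; exact: key.
Qed.

End SourceRescaling.

Section TargetRescaling.
Variables (R : realType) (d : nat) (Y Z : finType) (P : portrait d Y Z).
Variables (Fn : nat -> RatF R P) (F : RatHat R P).
Local Notation C := R[i].

(** Such points make the values of [pencil_map] at them independent in the limit, as
[cover_formula] requires for locating the marked points of the target. *)
Lemma two_values (f : ratmap R) (a : Y -> P1 R) : exists x1 x2 : C * C,
  [/\ nonzero x1, nonzero x2, forall y, wedge x1 (hlift (a y)) != 0,
      forall y, wedge x2 (hlift (a y)) != 0 & f (hp x1) != f (hp x2)].
Proof.
pose s := [seq a y | y <- enum Y].
have sP y : a y \in s by rewrite map_f // mem_enum.
have [x1 [n1 x1s]] := P1_avoid s.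
have [t tP] := fiber_finite f (f (hp x1)).
have [x2 [n2 x2s]] := P1_avoid (s ++ t).
exists x1, x2; split=> // [y|y|].
- exact/x1s.
- by apply: x2s; rewrite mem_cat sP.
apply/eqP => e; have /x2s : hp x2 \in s ++ t by rewrite mem_cat tP ?orbT.
have [k k0 xE] := hp_lift_scale n2.
by rewrite {1}xE wedge_scalel wedgexx mulr0 eqxx.
Qed.

Lemma uniform_cvg_of_ball (T : choiceType) (A : set T) (g : nat -> T -> P1 R) (f : T -> P1 R) :
  (forall e : R, 0 < e -> \forall n \near \oo, forall x, A x -> ball (f x) e (g n x)) ->
  {uniform A, g @ \oo --> f}.
Proof.
move=> h Q /uniform_nbhs[E [entE EQ]]; apply: filterS EQ _.
move: entE; rewrite -entourage_ballE => -[e /= e0 sub].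
by apply: filterS (h e e0) => n hn x Ax; apply: sub; exact: hn.
Qed.

Lemma mob_inv_id (p : P1 R) : mob_inv (mob_id R) p = p.
Proof. by rewrite -{1}[p]mob_idE mob_invK. Qed.

Lemma isolation_radius (p : P1 R) (a : Y -> P1 R) : (forall y, a y != p) ->
  exists2 r : R, 0 < r & forall y, ~ ball p (2 * r) (a y).
Proof.
move=> ap; have /choice[r rP] y : exists r : R, 0 < r /\ ~ ball p r (a y).
  have pa : p != a y by rewrite eq_sym.
  by have [e e0 ne] := P1_separated pa; exists e.
pose m := \big[Order.min/1]_y r y.
have m0 : 0 < m by apply: lt_bigmin => // y _; case: (rP y).
exists (m / 2) => [|y]; first by rewrite divr_gt0.
have -> : 2 * (m / 2) = m by field.
move=> /(le_ball _) h; have [_ []] := rP y; apply: h.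
exact: bigmin_inf.
Qed.

(** [cover_formula] applies to the limit at [v], with lifts [a y] of its marked
points, and to each [Fn n], with lifts [b y n] of the rescaled ones that converge
to [a y]. The formulas being the same, everything passes to the limit. *)
Lemma ts_converges_of_Imap_cvg :
  (fun n => Imap (cover_class (Fn n))) @ \oo --> Imap (cover_class F) ->
  ts_converges Fn F.
Proof.
move=> cvgI v w; have [phiY cY] := source_rescaling v cvgI.
pose a y : C * C := hlift (marking v y).
have /choice[b bP] y : exists b : nat -> C * C,
    (forall n, nonzero (b n) /\ hp (b n) = phiY n (rf_aY (Fn n) y)) /\ lift_cvg b (a y).
  by have [b bP] := P1_cvg_lift (cY y); exists b.
have bn n y := (bP y).1 n.
have ba y : lift_cvg (b y) (a y) := (bP y).2.
have [z0 [z1 [_ /uniq3[t01 _ _]]]] := tripod_of_vertex w.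
have aP y : nonzero (a y) /\ hp (a y) = mob_id R (marking v y).
  by rewrite lift_nonzero hp_lift mob_idE.
have [L [Lmap Lmark]] := cover_formula (rh_portrait F) aP t01.
pose v1 n := the_vertex (rf_src (Fn n)).
have t01n n : toward (tm_int (tc_map (Fn n)) (v1 n)) z0 !=
    toward (tm_int (tc_map (Fn n)) (v1 n)) z1.
  rewrite !(one_vertex_toward (rf_tgt (Fn n))).
  by apply: contra t01 => /eqP[->].
have /choice[Ln LnP] n := cover_formula (rh_portrait (Fn n)) (bn n) (t01n n).
have aZE n z : marking (tm_int (tc_map (Fn n)) (v1 n)) z = rf_aZ (Fn n) z.
  by rewrite /rf_aZ; congr marking; apply: one_vertex; exact: rf_tgt.
pose G := pencil_map P a z0 z1; pose Gn n := pencil_map P (fun y => b y n) z0 z1.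
exists phiY, (fun n => mob_comp (mob_inv L) (Ln n)); split=> [//|z|].
  (* The marked points of the target: [pencil_mark] is continuous. *)
  have [x1 [x2 [n1 n2 off1 off2 fx]]] := two_values (tc_fun F v) (marking v).
  have W0 : wedge (G x1) (G x2) != 0.
    rewrite wedge_eq0; try by rewrite /nonzero /G /= fiber_form_neq0.
    by rewrite -!Lmap // (inj_eq (@mob_inj R L)) !mob_inv_id.
  have [r0 rE] := Lmark z x1 x2 off1 off2 W0.
  have bd (x : C * C) :
      bounded_on [set: unit] (fun=> x.1) /\ bounded_on [set: unit] (fun=> x.2).
    by split; exact: bounded_cst.
  have form x z' := ucvg_fiber_form P ba (g := fun=> x) (bd x).1 (bd x).2 z'.
  have offn x : (forall y, wedge x (a y) != 0) ->
      \forall n \near \oo, forall y, wedge x (b y n) != 0.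
    move=> off; apply: filter_forall => y.
    have := ucvg_wedge_lift ba (g := fun=> x) (bd x).1 (bd x).2 y.
    move=> /ucvg_neq0 h; have : bounded_below [set: unit] (fun=> wedge x (a y)).
      by exists (cabs (wedge x (a y))); rewrite ?cabs_gt0.
    by move=> /h; apply: filterS => n /(_ tt I).
  have Wn : \forall n \near \oo, wedge (Gn n x1) (Gn n x2) != 0.
    have cW : ucvg [set: unit] (fun n _ => wedge (Gn n x1) (Gn n x2))
        (fun=> wedge (G x1) (G x2)).
      by apply: ucvg_wedge; exact: form.
    have low : bounded_below [set: unit] (fun=> wedge (G x1) (G x2)).
      by exists (cabs (wedge (G x1) (G x2))); rewrite ?cabs_gt0.
    by apply: filterS (ucvg_neq0 cW low) => n /(_ tt I).
  have cmark : (fun n => hp (pencil_mark P (fun y => b y n) z0 z1 z x1 x2)) @ \oo -->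
      hp (pencil_mark P a z0 z1 z x1 x2).
    by apply: (hp_cvg r0 _ _).2; apply: ucvgB; apply: ucvgM; exact: form.
  rewrite -[marking w z](mob_invK L) rE.
  apply/cvg_ballP => e e0; have /cvg_ballP/(_ e e0) := mob_cvg (m := mob_inv L) cmark.
  apply: filterS3 (filterI (offn _ off1) (offn _ off2)) Wn => n [h1 h2] Wn' close.
  have [_ /(_ z x1 x2 h1 h2 Wn')[_ e1]] := LnP n.
  by rewrite mob_compE -aZE e1.
(* Locally uniform convergence near [p]: the ball of radius [r] stays at distance
   [r] from the marked points, where the limit forms vanish. *)
move=> p npY.
have [r r0 far] : exists2 r : R, 0 < r & forall y, ~ ball p (2 * r) (marking v y).
  apply: isolation_radius => y; apply/eqP => e; apply: npY.
  by exists (toward v y); [exact: toward_adj|rewrite -e].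
exists (ball p r); first exact: nbhsx_ballx.
apply: uniform_cvg_of_ball => e e0.
(* Uniform estimates on the ball require bounded lifts of its points. *)
pose S : set (C * C) :=
  [set x | [/\ cabs x.1 <= 1, cabs x.2 <= 1, 1 <= nsq x & ball p r (hp x)]].
have S1 : bounded_on S (fun x => x.1) by exists 1 => // x [].
have S2 : bounded_on S (fun x => x.2) by exists 1 => // x [].
have low y : bounded_below S (fun x => wedge x (a y)).
  exists (r / 2) => [|x [_ _ x1 xp]]; first by rewrite divr_gt0.
  by apply: (wedge_near r0 (nsq_hlift _) x1 _ xp); rewrite hp_lift; exact: far.
have form z' := ucvg_fiber_form P ba S1 S2 z' (g := id).
have [mr mr0 mob_r] := mob_unif (mob_inv L) e0.
have offn : \forall n \near \oo, forall y x, S x -> wedge x (b y n) != 0.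
  apply: filter_forall => y.
  exact: ucvg_neq0 (ucvg_wedge_lift ba S1 S2 y (g := id)) (low y).
have lowG : bounded_below S (fun x => (G x).1).
  by apply: bounded_below_prod => y; apply: bounded_belowX.
have := @hp_ucvg R _ S Gn G (form z0) (form z1) (or_introl lowG) mr mr0.
apply: filterS2 offn => n off close q pq.
have [x xq [x1 x2 xn]] := P1_lift_bounded q.
have Sx : S x by rewrite /S /= xq.
have x0 : nonzero x by rewrite -nsq_gt0 (lt_le_trans ltr01).
have offa y : wedge x (a y) != 0.
  by have [c c0 cS] := low y; rewrite -cabs_gt0 (lt_le_trans c0) // cS.
have [_ ball_x] := close x Sx.
have fE : tc_fun F v q = mob_inv L (hp (G x)).
  by rewrite -Lmap // mob_inv_id mob_invK xq.
have [fnE _] := LnP n.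
rewrite fE /= mob_compE -xq /rf_fun -/(v1 n) fnE //; first exact: mob_r.
by move=> y; exact: off.
Qed.

End TargetRescaling.

Theorem corollary3p12 (R : realType) (d : nat) (Y Z : finType)
    (hd : (2 <= d)%N) (hY : (3 <= #|Y|)%N) (hZ : (3 <= #|Z|)%N)
    (P : portrait d Y Z) (Fn : nat -> RatF R P) (F : RatHat R P) :
  ts_converges Fn F <->
  ((fun n => Imap (cover_class (Fn n))) @ \oo --> Imap (cover_class F)).
Proof. by split; [exact: Imap_cvg_of_ts_converges|exact: ts_converges_of_Imap_cvg]. Qed.
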